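(* Let $L$ be a CM-field with maximal real subfield $K$, and let $w_L$ be the number of roots of unity in $L$. (i) Suppose $w_L \equiv 2 \pmod 4$. 1. If $L/K$ is essentially ramified, then $Q(L)=1$ and $\kappa_{L/K}=1$. 2. If $L/K$ is not essentially ramified, then $L=K(\sqrt{\alpha})$ for some $\alpha\in\mathcal O_K$ with $\alpha\mathcal O_K=\mathfrak a^2$ for an integral ideal $\mathfrak a$ of $\mathcal O_K$; for such $\alpha$ and $\mathfrak a$: (a) if $\mathfrak a$ is principal, then $Q(L)=2$; (b) if $\mathfrak a$ is not principal, then $Q(L)=1$ and $\kappa_{L/K}=\langle[\mathfrak a]\rangle$. (ii) Suppose $w_L\equiv 2^m \pmod{2^{m+1}}$ for some integer $m\ge 2$. Then $L/K$ is not essentially ramified, and: 1. if $\pi_m\mathcal O_K$ is not the square of an ideal, then $Q(L)=1$ and $\kappa_{L/K}=1$; 2. if $\pi_m\mathcal O_K=\mathfrak b^2$ for some integral ideal $\mathfrak b$ of $\mathcal O_K$, then (a) $Q(L)=2$ if $\mathfrak b$ is principal, and (b) $Q(L)=1$ and $\kappa_{L/K}=\langle[\mathfrak b]\rangle$ if $\mathfrak b$ is not principal.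
   Context: All number fields are subfields of $\mathbb C$. A CM-field is a totally complex quadratic extension of a totally real number field; its maximal real subfield is the fixed field of complex conjugation $\sigma$. For a number field $F$: $\mathcal O_F$ is its ring of integers, $E_F$ its unit group, $W_F$ its group of roots of unity, $\mathrm{Cl}(F)$ its ideal class group, and $[\mathfrak a]$ the class of an ideal $\mathfrak a$. Hasse's unit index is $Q(L)=(E_L:W_LE_K)\in\{1,2\}$. The capitulation kernel $\kappa_{L/K}$ is the kernel of the map $\mathrm{Cl}(K)\to\mathrm{Cl}(L)$ induced by $\mathfrak a\mapsto\mathfrak a\mathcal O_L$. $L/K$ is called essentially ramified if, writing $L=K(\sqrt\alpha)$ with $\alpha\in K$, there is a prime ideal $\mathfrak p$ of $\mathcal O_K$ whose exact power dividing $\alpha$ is odd (this does not depend on the choice of $\alpha$). For $n\ge 2$, $\pi_n=2+\zeta_{2^n}+\zeta_{2^n}^{-1}$ where $\zeta_{2^n}=e^{2\pi i/2^n}$ (so $\pi_2=2$, $\pi_3=2+\sqrt2$, $\pi_n=2+\sqrt{\pi_{n-1}}$). *)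

(* Defs.v *)
(* number fields are modelled as subfields of algC
   (the algebraic closure of Q, i.e. the algebraic complex numbers). *)
From HB Require Import structures.
From mathcomp Require Import all_boot all_order all_algebra all_field.
Set Implicit Arguments. Unset Strict Implicit. Unset Printing Implicit Defensive.
Import Order.TTheory GRing.Theory Num.Theory.
Local Open Scope ring_scope.

Definition cset := algC -> Prop.

Definition set_eq (A B : cset) : Prop := forall x, A x <-> B x.

Definition Q_pred : cset := fun x => x \in Crat.

Definition span_over (K : cset) (s : seq algC) (x : algC) : Prop :=
  exists c : seq algC, size c = size s /\ (forall i, (i < size c)%N -> K c`_i) /\
    x = \sum_(i < size s) c`_i * s`_i.

Definition basis_over (K F : cset) (s : seq algC) : Prop :=
  (forall i, (i < size s)%N -> F s`_i) /\
  (forall x, F x <-> span_over K s x) /\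
  (forall c : seq algC, size c = size s -> (forall i, (i < size c)%N -> K c`_i) ->
     \sum_(i < size s) c`_i * s`_i = 0 -> forall i, (i < size c)%N -> c`_i = 0).

Definition is_subfield (F : cset) : Prop :=
  F 0 /\ F 1 /\ (forall x y, F x -> F y -> F (x + y)) /\ (forall x, F x -> F (- x)) /\
  (forall x y, F x -> F y -> F (x * y)) /\ (forall x, F x -> F (x^-1)).

Definition number_field (F : cset) : Prop :=
  is_subfield F /\ exists s, basis_over Q_pred F s.

Definition embedding (F : cset) (f : algC -> algC) : Prop :=
  f 1 = 1 /\ (forall x y, F x -> F y -> f (x + y) = f x + f y) /\
  (forall x y, F x -> F y -> f (x * y) = f x * f y).

Definition totally_real (F : cset) : Prop :=
  forall f, embedding F f -> forall x, F x -> f x \is Creal.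

Definition totally_complex (F : cset) : Prop :=
  forall f, embedding F f -> exists x, F x /\ f x \isn't Creal.

Definition CM_field (L K : cset) : Prop :=
  number_field L /\ number_field K /\ (forall x, K x -> L x) /\
  totally_real K /\ totally_complex L /\ exists s, size s = 2%N /\ basis_over K L s.

Definition OF (F : cset) : cset := fun x => F x /\ x \in Aint.
Definition EF (F : cset) : cset := fun x => OF F x /\ exists y, OF F y /\ x * y = 1.
Definition WF (F : cset) : cset := fun x => F x /\ exists n, (0 < n)%N /\ x ^+ n = 1.

Definition num_roots_of_unity (F : cset) (w : nat) : Prop :=
  exists s : seq algC, uniq s /\ size s = w /\ forall x, WF F x <-> x \in s.

Definition WE (L K : cset) : cset :=
  fun x => exists u e, WF L u /\ EF K e /\ x = u * e.
Definition unit_index (L K : cset) (n : nat) : Prop :=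
  exists s : seq algC, size s = n /\ (forall i, (i < n)%N -> EF L s`_i) /\
    forall x, EF L x ->
      (exists i, (i < n)%N /\ WE L K (x / s`_i)) /\
      (forall i j, (i < n)%N -> (j < n)%N -> WE L K (x / s`_i) -> WE L K (x / s`_j) -> i = j).

Definition int_ideal (F : cset) (A : cset) : Prop :=
  (forall x, A x -> OF F x) /\ A 0 /\ (forall x y, A x -> A y -> A (x + y)) /\
  (forall r x, OF F r -> A x -> A (r * x)).

Definition nonzero_ideal (F : cset) (A : cset) : Prop :=
  int_ideal F A /\ exists x, A x /\ x != 0.

Definition ideal_gen (F : cset) (S : cset) : cset :=
  fun x => exists (g r : seq algC), size g = size r /\
    (forall i, (i < size g)%N -> S g`_i) /\ (forall i, (i < size r)%N -> OF F r`_i) /\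
    x = \sum_(i < size g) r`_i * g`_i.

Definition principal_gen (F : cset) (a : algC) : cset := ideal_gen F (fun x => x = a).

Definition ideal_mul (F : cset) (A B : cset) : cset :=
  ideal_gen F (fun x => exists a b, A a /\ B b /\ x = a * b).

Fixpoint ideal_pow (F : cset) (A : cset) (k : nat) : cset :=
  match k with
  | 0%N => OF F
  | k'.+1 => ideal_mul F (ideal_pow F A k') A
  end.

Definition ideal_ext (L : cset) (A : cset) : cset := ideal_gen L A.

Definition principal (F : cset) (A : cset) : Prop :=
  exists a, OF F a /\ set_eq A (principal_gen F a).

Definition scale (x : algC) (A : cset) : cset := fun z => exists a, A a /\ z = x * a.
Definition same_class (F : cset) (A B : cset) : Prop :=
  exists x y, OF F x /\ OF F y /\ x != 0 /\ y != 0 /\ set_eq (scale x A) (scale y B).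

(* the capitulation kernel of Cl(K) -> Cl(L) is trivial
   (every ideal class of K contains a nonzero integral ideal) *)
Definition capitulation_trivial (L K : cset) : Prop :=
  forall C, nonzero_ideal K C -> principal L (ideal_ext L C) -> principal K C.

Definition capitulation_gen (L K : cset) (A : cset) : Prop :=
  forall C, nonzero_ideal K C ->
    (principal L (ideal_ext L C) <-> exists k, same_class K C (ideal_pow K A k)).

Definition prime_ideal (F : cset) (P : cset) : Prop :=
  nonzero_ideal F P /\ ~ P 1 /\
  forall a b, OF F a -> OF F b -> P (a * b) -> P a \/ P b.

Definition ideal_divides (F : cset) (A B : cset) : Prop :=
  exists C, int_ideal F C /\ set_eq B (ideal_mul F A C).
Definition exact_power (F : cset) (P : cset) (x : algC) (e : nat) : Prop :=
  ideal_divides F (ideal_pow F P e) (principal_gen F x) /\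
  ~ ideal_divides F (ideal_pow F P e.+1) (principal_gen F x).

Definition gen_by_sqrt (L K : cset) (alpha : algC) : Prop :=
  K alpha /\ exists beta, L beta /\ beta ^+ 2 = alpha /\
    forall x, L x <-> exists a b, K a /\ K b /\ x = a + b * beta.

(* L/K is essentially ramified: for alpha in K with L = K(sqrt alpha),
   some prime of O_K divides alpha to an odd exact power
   (alpha = x / y with x, y in O_K, v(alpha) = v(x) - v(y)). *)
Definition essentially_ramified (L K : cset) : Prop :=
  exists alpha, gen_by_sqrt L K alpha /\
    exists P x y ex ey, prime_ideal K P /\ OF K x /\ OF K y /\ x != 0 /\ y != 0 /\
      alpha * y = x /\ exact_power K P x ex /\ exact_power K P y ey /\ odd (ex + ey).

(* pi_n = 2 + zeta_{2^n} + zeta_{2^n}^{-1}, zeta_{2^n} = e^{2 pi i / 2^n}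
   = (2^(n-1)).-root (-1) (nth root with minimal nonnegative argument) *)
Definition zeta2 (n : nat) : algC := (2 ^ n.-1)%N.-root (-1).
Definition pi_n (n : nat) : algC := 2 + zeta2 n + (zeta2 n)^-1.

(* Main.v *)
(* Complex conjugation sends a unit [e] of L to a unit with [e^* / e] on the unit circle in every embedding, hence to a root of unity (Kronecker); likewise for a generator of an ideal C O_L with C an ideal of K. If w is even and [omega] is a root of unity that is not a square of a root of unity, every root of unity is a square or [omega^-1] times a square. Fix [theta] with [theta^* = theta / omega]: [theta = sqrt alpha] for [omega = -1], and [theta = 1 + zeta] for [omega = zeta] of order 2^m. A square quotient means that the unit lies in W_L E_K, respectively that C is principal. Otherwise, after a twist by a root of unity, the element is [k * theta] with [k] in K, and its norm [k ^ 2 * theta * theta^*] generates the unit ideal, respectively C ^ 2. So everything is governed by the ideals B of K whose square is generated by [theta * theta^*]; such a B is unique because O_K is integrally closed, and [theta * theta^*] is [- alpha] or [pi_m]. Only essential ramification involves prime ideals. *)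
Require Import Defs.
From HB Require Import structures.
From mathcomp Require Import all_boot all_order all_algebra all_field.
From mathcomp Require Import ring zify.
From Stdlib Require Import Classical FunctionalExtensionality PropExtensionality.
Set Implicit Arguments. Unset Strict Implicit. Unset Printing Implicit Defensive.
Import Order.TTheory GRing.Theory Num.Theory.
Local Open Scope ring_scope.

(** * Algebraic integers *)

(** Embeddings are used only through automorphisms of algC, and the decisive property of a CM-field
    is that on L they all commute with complex conjugation. Ideals are [O_F]-submodules of algC, so
    that scaling by field elements covers fractional ideals and ideal classes alike. Essential
    ramification requires valuations, hence inverses of prime ideals; these come from the finiteness
    of O_F / (d), which rests on the fact that a family in O_F independent modulo a prime p has at
    most [F : Q] members. The choice of [omega] comes from the map eta -> eta ^ (w / 2) with values
    1 and -1 on the roots of unity, whose kernel is the squares: -1 has value -1 when w / 2 is odd,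
    and a primitive root of order 2^m has value -1 when 2^m exactly divides w. *)

Lemma Aint_integralOver (x : algC) :
  reflect (integralOver (intr : int -> algC) x) (x \in Aint).
Proof.
apply: (iffP idP) => [Ax | [p mon_p px0]].
  have /floorpP[p Dp] : minCpoly x \is a polyOver Num.int by [].
  exists p; last by rewrite -Dp root_minCpoly.
  have := minCpoly_monic x; rewrite Dp !monicE lead_coef_map_inj //; last exact: intr_inj.
  by rewrite (inj_eq intr_inj _ 1).
apply: root_monic_Aint px0 _ _.
  by rewrite monicE lead_coef_map_inj ?(monicP mon_p) //; apply: intr_inj.
by apply/polyOverP=> i; rewrite coef_map /=.
Qed.

Lemma Aint_root_monic (p : {poly algC}) u :
  p \is monic -> p \is a polyOver Aint -> root p u -> u \in Aint.
Proof.
move=> mon_p Ap pu0; apply/Aint_integralOver/(integral_root_monic mon_p pu0).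
move=> c /(nthP 0)[i _ <-]; apply/Aint_integralOver.
exact: (polyOverP Ap).
Qed.

Lemma Aint_sqr u : u ^+ 2 \in Aint -> u \in Aint.
Proof.
move=> Au; apply: (@Aint_root_monic ('X^2 - (u ^+ 2)%:P)).
- exact: monicXnsubC.
- by rewrite rpredB ?rpredX ?polyOverX ?polyOverC.
- by rewrite rootE !hornerE subrr.
Qed.

(** If [q], equal to [a] times the minimal polynomial over Q, has integer coefficients, its leading
    coefficient is [a]; multiplying [q] by the power of [a] one below its degree turns it into a
    monic integer polynomial [r] in [a * x]. *)
Lemma Aint_multiplier (x : algC) : exists2 N : nat, N != 0%N & N%:R * x \in Aint.
Proof.
have [p [_ mon_p] /(_ p) pz0] := minCpolyP x; rewrite dvdpp in pz0.
have [q [a a0 Dp]] := rat_poly_scale p.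
set b : algC := a%:~R.
have b0 : b != 0 by rewrite intr_eq0.
have Ep : map_poly ratr p = b^-1 *: map_poly (intr : int -> algC) q.
  rewrite Dp map_polyZ /= fmorphV rmorph_int -map_poly_comp; congr (_ *: _).
  by apply: eq_map_poly => c /=; rewrite ratr_int.
have Eq : map_poly (intr : int -> algC) q = b *: map_poly ratr p.
  by rewrite Ep scalerA divff // scale1r.
set d := (size p).-1.
have sp : size p = d.+1 by rewrite prednK // lt0n size_poly_eq0 monic_neq0.
pose r := \poly_(i < d.+1) (if i == d :> nat then 1 else (q`_i)%:~R * b ^+ (d.-1 - i) : algC).
have qd : b * (map_poly ratr p)`_d = b.
  by rewrite coef_map /= -[d]/(size p).-1 -lead_coefE (monicP mon_p) rmorph1 mulr1.
have Ab : b * x \in Aint.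
  have rd : r`_d = 1 by rewrite coef_poly ltnSn eqxx.
  have szr : size r = d.+1 by rewrite size_poly_eq // eqxx oner_eq0.
  apply: (@Aint_root_monic r).
  - by rewrite monicE lead_coefE szr rd.
  - apply/polyOverP=> i; rewrite coef_poly; do 2?case: ifP => _; rewrite ?rpred0 ?rpred1 //.
    by rewrite rpredM ?rpredX ?Aint_int.
  - case: d sp @r qd rd szr => [|d] sp r qd rd szr.
      move: pz0; have /size_poly1P[c c0 ->] : size p == 1%N by rewrite sp.
      by rewrite map_polyC /= rootC fmorph_eq0 (negPf c0).
    rewrite rootE horner_coef szr big_ord_recr /= rd mul1r.
    have: (map_poly ratr p : {poly algC}).[x] = 0 by apply/eqP.
    rewrite horner_coef size_map_poly sp big_ord_recr /=.
    move=> /(congr1 (fun y => b ^+ d * (b * y))); rewrite !mulr0 => H0.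
    apply/eqP; rewrite -[RHS]H0 !mulrDr; congr (_ + _); last first.
      rewrite [b * (_ * _)]mulrA qd exprMn; rewrite exprSr; ring.
    rewrite !mulr_sumr. apply: eq_bigr => i _.
    rewrite coef_poly ltnS (ltnW (ltn_ord i)) ltn_eqF ?ltn_ord //.
    have -> : (q`_i)%:~R = b * (map_poly (ratr : rat -> algC) p)`_i.
      by rewrite -coefZ -Eq coef_map.
    have <- : b ^+ (d - i) * b ^+ i = b ^+ d by rewrite -exprD subnK // -ltnS.
    rewrite exprMn; ring.
exists `|a|%N; first by rewrite absz_eq0.
by rewrite pmulrn abszEsign rmorphMsign -mulrA rpredMsign.
Qed.

(** The determinant trick: the characteristic polynomial of an integral matrix is monic with
    integral coefficients. *)
Lemma Aint_eigen n (M : 'M[algC]_n) (g : 'cV[algC]_n) u :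
  (forall i j, M i j \in Aint) -> g != 0 -> M *m g = u *: g -> u \in Aint.
Proof.
move=> AM g0 Mg.
apply: (@Aint_root_monic (char_poly M^T)); first exact: char_poly_monic.
  rewrite /char_poly /determinant rpred_sum // => s _.
  rewrite rpredM ?rpredX ?rpredN ?rpred1 // rpred_prod // => i _.
  rewrite /char_poly_mx !mxE rpredB ?polyOverC ?mxE ?AM //.
  by case: (_ == _); rewrite ?polyOverX ?rpred0.
rewrite -eigenvalue_root_char; apply/eigenvalueP; exists g^T.
  by rewrite -trmx_mul Mg linearZ.
by rewrite -(inj_eq (@trmx_inj _ _ _)) trmxK linear0.
Qed.

(** * Conjugates and Kronecker's theorem *)

(** The roots of the minimal polynomial generate a normal extension [Qn] of Q, in which a Galois
    automorphism carries [x] to [y]; it extends to all of algC. *)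
Lemma minCpoly_conj_exists x y :
  root (minCpoly x) y -> exists nu : {rmorphism algC -> algC}, nu x = y.
Proof.
move=> xy.
have [r Dr] := closed_field_poly_normal (minCpoly x : {poly algC}).
rewrite (monicP (minCpoly_monic x)) scale1r in Dr.
have [p [Dp mon_p] min_p] := minCpolyP x.
have [Qr [QrC [rr Drr genQr]]] := num_field_exists r.
have Dpr : map_poly (in_alg Qr) p = \prod_(z <- rr) ('X - z%:P).
  apply: (map_poly_inj QrC); rewrite -map_poly_comp.
  rewrite (eq_map_poly (_ : _ =1 ratr)) => [|a /=]; last by rewrite rmorphZ_num rmorph1 mulr1.
  rewrite -Dp Dr -Drr big_map rmorph_prod /=.
  by apply: eq_bigr => z _; rewrite map_polyXsubC.
have splitQr : SplittingField.axiom Qr.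
  exists (map_poly (in_alg Qr) p).
    by apply/polyOverP=> i; rewrite coef_map /= memvZ ?mem1v.
  by exists rr => //; rewrite Dpr eqpxx.
pose QrM := FieldExt_isSplittingField.Build rat Qr splitQr.
pose Qn : splittingFieldType rat := HB.pack Qr QrM.
have rootr z : root (minCpoly x) z -> exists2 zz : Qn, QrC zz = z & root (map_poly (in_alg Qr) p) zz.
  rewrite Dr root_prod_XsubC -Drr => /mapP[zz zr ->]; exists zz => //.
  by rewrite Dpr root_prod_XsubC.
have [xx Dx _] := rootr x (root_minCpoly x).
have [yy Dy pyy] := rootr y xy.
have rxy : root (minPoly 1%AS xx : {poly Qn}) yy.
  have /polyOver1P[q Dq] := minPolyOver 1%AS xx.
  have : root (map_poly (ratr : rat -> algC) q) x.
    have := root_minPoly 1%AS xx; rewrite -(fmorph_root QrC) Dx Dq -map_poly_comp.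
    by rewrite (eq_map_poly (_ : _ =1 ratr)) // => a /=; rewrite rmorphZ_num rmorph1 mulr1.
  rewrite min_p => /dvdpP[s Ds]; rewrite Dq Ds rmorphM rootM; apply/orP; right; exact: pyy.
have [s _ sxy] := normalField_root_minPoly (sub1v _) (normalFieldf 1%AS) (memvf xx) rxy.
have sM : monoid_morphism (s : Qr -> Qr) by split; [apply: rmorph1 | apply: rmorphM].
have sA : zmod_morphism (s : Qr -> Qr) by apply: rmorphB.
pose sAM := GRing.isZmodMorphism.Build Qr Qr s sA.
pose sMM := GRing.isMonoidMorphism.Build Qr Qr s sM.
pose phi : {rmorphism Qr -> Qr} := HB.pack (s : Qr -> Qr) sAM sMM.
have [nu Dnu] := extend_algC_subfield_aut QrC phi.
by exists nu; rewrite -Dx -Dnu /= -Dy; congr (QrC _).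
Qed.

(** A root [r] shared with the derivative is conjugate to [x], so it has the same minimal
    polynomial, which would then divide its own derivative of smaller degree. *)
Lemma minCpoly_uniq_roots x :
  exists2 rs : seq algC, minCpoly x = \prod_(r <- rs) ('X - r%:P) & uniq rs.
Proof.
have [rs Drs] := closed_field_poly_normal (minCpoly x : {poly algC}).
rewrite (monicP (minCpoly_monic x)) scale1r in Drs; exists rs => //.
rewrite -separable_prod_XsubC -Drs unlock.
apply/Pdiv.ClosedField.coprimepP => r xr; apply/negP.
have [nu Dr] := minCpoly_conj_exists xr.
have [p [Dp mon_p] min_p] := minCpolyP r.
have Dx : minCpoly x = map_poly ratr p by rewrite -(minCpoly_aut nu x) Dr.
rewrite Dx deriv_map -rootE min_p => /dvdp_leq.
have sp : (1 < size p)%N by have := size_minCpoly x; rewrite Dx size_map_poly.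
have p'0 : p^`() != 0.
  case: (size p) (lead_coefE p) sp => [|[|d]] // lp _.
  apply/eqP=> /(congr1 (fun q : {poly rat} => q`_d)).
  by rewrite coef_deriv coef0 -lp (monicP mon_p) => /eqP; rewrite pnatr_eq0.
by move=> /(_ p'0); rewrite leqNgt lt_size_deriv // monic_neq0.
Qed.

Lemma coef_prod_XsubC_bound (rs : seq algC) i :
  (forall r, r \in rs -> `|r| = 1) ->
  `|(\prod_(r <- rs) ('X - r%:P))`_i| <= 2 ^+ size rs.
Proof.
elim: rs i => [|r rs IH] i rs1.
  by rewrite big_nil coef1; case: (i == 0%N); rewrite ?normr1 ?normr0 ?expr0 ?ler01.
have {}IH j := IH j (fun s Hs => rs1 s (@mem_behead _ (r :: rs) s Hs)).
rewrite big_cons mulrBl coefB coefXM coefCM /= exprS mulr_natl mulr2n.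
apply: le_trans (ler_normB _ _) _; rewrite normrM (rs1 r) ?mem_head // mul1r lerD //.
by case: ifP => _ //; rewrite normr0 exprn_ge0.
Qed.

Lemma finite_polys (R : nzRingType) (B : seq R) k :
  exists Ps : seq {poly R}, forall p : {poly R},
    (size p <= k)%N -> (forall i, p`_i \in B) -> p \in Ps.
Proof.
elim: k => [|k [Ps IH]].
  by exists [:: 0] => p; rewrite leqn0 size_poly_eq0 => /eqP-> _; rewrite mem_head.
exists [seq q * 'X + c%:P | q <- Ps, c <- B] => p sp Bp.
rewrite -(poly_take_drop 1 p) addrC expr1.
have -> : take_poly 1 p = (p`_0)%:P.
  by apply/polyP=> j; rewrite coef_take_poly coefC; case: j.
apply/allpairsP; exists (drop_poly 1 p, p`_0); split=> //=.
by apply: IH => [|j]; rewrite ?size_drop_poly ?coef_drop_poly // leq_subLR.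
Qed.

Lemma bounded_ints (N : nat) :
  exists B : seq algC, forall c : algC, c \in Num.int -> `|c| <= N%:R -> c \in B.
Proof.
exists [seq (i%:Z - N%:Z)%:~R | i <- iota 0 N.*2.+1] => _ /intrP[m ->].
rewrite -intr_norm -[N%:R]/(N%:Z%:~R) ler_int => mN.
apply/mapP; exists (absz (m + N%:Z)).
  by rewrite mem_iota; lia.
by congr _%:~R; lia.
Qed.

(* All powers of [x] are algebraic integers of bounded degree whose conjugates lie on the unit circle; only finitely many integer polynomials can occur as their minimal polynomials. *)
Theorem kronecker x :
  x \in Aint -> (forall nu : {rmorphism algC -> algC}, `|nu x| = 1) ->
  exists2 n, (0 < n)%N & x ^+ n = 1.
Proof.
move=> Ax nx1; have [rs0 D0 U0] := minCpoly_uniq_roots x.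
pose d := size rs0.
have [B HB] := bounded_ints (2 ^ d).
have [Ps HP] := finite_polys B d.+1.
have [roots Hroots] : exists roots : seq algC, forall p y, p \in Ps -> p != 0 -> root p y -> y \in roots.
  elim: Ps {HP} => [|p Ps [ys IH]]; first by exists [::].
  have [->|p0] := eqVneq p 0.
    exists ys => q y; rewrite inE => /orP[/eqP->|]; first by rewrite eqxx.
    exact: IH.
  have [zs Dzs] := closed_field_poly_normal p.
  exists (zs ++ ys) => q y; rewrite inE mem_cat => /orP[/eqP->|qP q0 qy].
    by move=> _; rewrite Dzs rootZ ?lead_coef_eq0 // root_prod_XsubC => ->.
  by rewrite (IH q y) ?orbT.
have powx n : x ^+ n \in roots.
  apply: (Hroots (minCpoly (x ^+ n))); last exact: root_minCpoly.
    have [rs Drs Urs] := minCpoly_uniq_roots (x ^+ n).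
    have rsP r : r \in rs -> exists2 nu : {rmorphism algC -> algC}, r = nu x ^+ n & nu x \in rs0.
      rewrite -root_prod_XsubC -Drs => /minCpoly_conj_exists[nu <-].
      exists nu; first by rewrite rmorphXn.
      by rewrite -root_prod_XsubC -D0 -(minCpoly_aut nu x) root_minCpoly.
    (* The degree stays below [d] for every [n]: the roots in [rs] are distinct, and all are nth
       powers of elements of [rs0]. *)
    have srs : (size rs <= d)%N.
      rewrite -[d](size_map (fun r => r ^+ n)); apply: uniq_leq_size => // r /rsP[nu -> nur].
      exact: map_f.
    apply: HP => [|i]; first by rewrite Drs size_prod_XsubC.
    apply: HB; first by have /polyOverP := rpredX n Ax; apply.
    rewrite Drs natrX; apply: le_trans (coef_prod_XsubC_bound _ _) _ => [r /rsP[nu -> _]|].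
      by rewrite normrX nx1 expr1n.
    by rewrite ler_weXn2l // ler1n.
  by rewrite minCpoly_eq0.
pose s := [seq x ^+ n | n <- iota 0 (size roots).+1].
have /(uniqPn 0)[i [j [ij js]]] : ~~ uniq s.
  apply/negP=> Us; have /(uniq_leq_size Us) : {subset s <= roots} by move=> _ /mapP[n _ ->].
  by rewrite size_map size_iota ltnn.
rewrite size_map size_iota in js.
rewrite !(nth_map 0%N) ?size_iota ?(ltn_trans ij) // !nth_iota ?(ltn_trans ij) // !add0n => Exx.
have x0 : x != 0 by have := nx1 idfun; rewrite /=; case: eqP => // ->; rewrite normr0 => /eqP; rewrite eq_sym oner_eq0.
exists (j - i)%N; first by rewrite subn_gt0.
apply: (mulfI (expf_neq0 i x0)); rewrite -exprD subnKC ?(ltnW ij) // mulr1.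
by rewrite -Exx.
Qed.

(** * Modules over a ring of integers *)

Lemma cset_ext (A B : cset) : set_eq A B -> A = B.
Proof.
by move=> AB; apply: functional_extensionality => x; apply: propositional_extensionality.
Qed.

Definition csub (A B : cset) : Prop := forall x, A x -> B x.

Lemma csub_antisym A B : csub A B -> csub B A -> A = B.
Proof. by move=> AB BA; apply: cset_ext => x; split; [apply: AB | apply: BA]. Qed.

Lemma csub_trans A B C : csub A B -> csub B C -> csub A C.
Proof. by move=> AB BC x /AB/BC. Qed.

(** Containment in [OF F], or even in [F], is not part of the notion: fractional ideals and
    auxiliary predicates qualify too. *)
Definition omod (F M : cset) : Prop :=
  M 0 /\ (forall x y, M x -> M y -> M (x + y)) /\
  (forall r x, OF F r -> M x -> M (r * x)).

Lemma scale_mem x A a : A a -> scale x A (x * a).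
Proof. by move=> Aa; exists a. Qed.

Lemma scale_scale x y A : scale x (scale y A) = scale (x * y) A.
Proof.
apply: csub_antisym => z [a].
  by case=> -[b [Ab ->]] ->; exists b; rewrite mulrA.
by case=> Aa ->; exists (y * a); rewrite mulrA; split=> //; exists a.
Qed.

Lemma scale1 A : scale 1 A = A.
Proof.
apply: csub_antisym => z; first by case=> a [Aa ->]; rewrite mul1r.
by move=> Az; exists z; rewrite mul1r.
Qed.

Lemma scaleK x A : x != 0 -> scale x^-1 (scale x A) = A.
Proof. by move=> x0; rewrite scale_scale mulVf // scale1. Qed.

Lemma scaleVK x A : x != 0 -> scale x (scale x^-1 A) = A.
Proof. by move=> x0; rewrite scale_scale mulfV // scale1. Qed.

Lemma scale_inj x A B : x != 0 -> scale x A = scale x B -> A = B.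
Proof. by move=> x0 /(congr1 (scale x^-1)); rewrite !scaleK. Qed.

Section Subfield.

Variable F : cset.
Hypothesis hF : is_subfield F.

Lemma sf0 : F 0. Proof. by case: hF. Qed.
Lemma sf1 : F 1. Proof. by case: hF => _ []. Qed.
Lemma sfD x y : F x -> F y -> F (x + y). Proof. by case: hF => _ [_ [+ _]]; apply. Qed.
Lemma sfN x : F x -> F (- x). Proof. by case: hF => _ [_ [_ [+ _]]]; apply. Qed.
Lemma sfB x y : F x -> F y -> F (x - y). Proof. by move=> Fx /sfN; apply: sfD. Qed.
Lemma sfM x y : F x -> F y -> F (x * y).
Proof. by case: hF => _ [_ [_ [_ [+ _]]]]; apply. Qed.
Lemma sfV x : F x -> F x^-1. Proof. by case: hF => _ [_ [_ [_ [_ +]]]]; apply. Qed.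
Lemma sfX x n : F x -> F (x ^+ n).
Proof. by move=> Fx; elim: n => [|n IH]; rewrite ?expr0 ?exprS; [apply: sf1 | apply: sfM]. Qed.
Lemma sf_nat n : F n%:R.
Proof. by elim: n => [|n IH]; [apply: sf0 | rewrite mulrS; apply: sfD => //; apply: sf1]. Qed.
Lemma sf_int (n : int) : F n%:~R.
Proof. by case: n => n; [apply: sf_nat | rewrite NegzE mulrNz; apply/sfN/sf_nat]. Qed.

Lemma of0 : OF F 0. Proof. by split; [apply: sf0 | apply: Aint0]. Qed.
Lemma of1 : OF F 1. Proof. by split; [apply: sf1 | apply: Aint1]. Qed.
Lemma ofD x y : OF F x -> OF F y -> OF F (x + y).
Proof. by move=> [Fx Ax] [Fy Ay]; split; [apply: sfD | apply: rpredD]. Qed.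
Lemma ofN x : OF F x -> OF F (- x).
Proof. by move=> [Fx Ax]; split; [apply: sfN | rewrite rpredN]. Qed.
Lemma ofB x y : OF F x -> OF F y -> OF F (x - y). Proof. by move=> Fx /ofN; apply: ofD. Qed.
Lemma ofM x y : OF F x -> OF F y -> OF F (x * y).
Proof. by move=> [Fx Ax] [Fy Ay]; split; [apply: sfM | apply: rpredM]. Qed.
Lemma ofX x n : OF F x -> OF F (x ^+ n).
Proof. by move=> [Fx Ax]; split; [apply: sfX | apply: rpredX]. Qed.
Lemma of_int (n : int) : OF F n%:~R.
Proof. by split; [apply: sf_int | apply: Aint_int]. Qed.
Lemma of_nat (n : nat) : OF F n%:R. Proof. exact: of_int n. Qed.

Lemma omodN M x : omod F M -> M x -> M (- x).
Proof. by case=> _ [_ MM] Mx; rewrite -mulN1r; apply: MM => //; apply/ofN/of1. Qed.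

Lemma omodB M x y : omod F M -> M x -> M y -> M (x - y).
Proof. by move=> oM Mx /(omodN oM); case: oM => _ [+ _]; apply. Qed.

Lemma omod_sum M n (f : nat -> algC) :
  omod F M -> (forall i, (i < n)%N -> M (f i)) -> M (\sum_(i < n) f i).
Proof.
case=> M0 [MD _] Mf; elim: n Mf => [|n IH] Mf; first by rewrite big_ord0.
by rewrite big_ord_recr /=; apply: MD; [apply: IH => i /ltnW/Mf | apply: Mf].
Qed.

Lemma omod_OF : omod F (OF F).
Proof. by split; [apply: of0 | split; [apply: ofD | apply: ofM]]. Qed.

Lemma omod_scale x M : omod F M -> omod F (scale x M).
Proof.
case=> M0 [MD MM]; split; first by exists 0; rewrite mulr0.
split=> [_ _ [a [Ma ->]] [b [Mb ->]]|r _ Or [a [Ma ->]]].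
  by exists (a + b); rewrite mulrDr; split=> //; apply: MD.
by exists (r * a); rewrite mulrCA; split=> //; apply: MM.
Qed.

(** Allows one factor of a product to be fixed while [gen_min] or [mul_min] runs over generators of
    the other. *)
Lemma omod_colon M y : omod F M -> omod F (fun x => M (x * y)).
Proof.
case=> M0 [MD MM]; split; first by rewrite mul0r.
split=> [a b Ma Mb|r a Or Ma]; first by rewrite mulrDl; apply: MD.
by rewrite -mulrA; apply: MM.
Qed.

(** * Generated ideals and products of ideals *)

Lemma gen_mem (S : cset) : csub S (ideal_gen F S).
Proof.
move=> x Sx; exists [:: x], [:: 1]; split=> //; split=> [[]|] //; split=> [[]//= _|].
  exact: of1.
by rewrite big_ord_recl big_ord0 /= mul1r addr0.
Qed.

(** Serves as the induction principle for generated ideals, with [M] the property to be proved. *)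
Lemma gen_min (S M : cset) : omod F M -> csub S M -> csub (ideal_gen F S) M.
Proof.
move=> oM SM _ [g [r [sgr [Sg [Or ->]]]]].
apply: (omod_sum (f := fun i => r`_i * g`_i) oM) => i ig.
by case: oM => _ [_ MM]; apply: MM; [apply: Or; rewrite -sgr | apply/SM/Sg].
Qed.

Lemma omod_gen (S : cset) : omod F (ideal_gen F S).
Proof.
split; first by exists [::], [::]; do 3!split=> //; rewrite big_ord0.
split=> [_ _ [g [r [sgr [Sg [Or ->]]]]] [h [s [shs [Sh [Os ->]]]]]|a _ Oa [g [r [sgr [Sg [Or ->]]]]]].
  exists (g ++ h), (r ++ s); split; first by rewrite !size_cat sgr shs.
  split=> [i|].
    rewrite size_cat nth_cat; case: (ltnP i (size g)) => [ig _|gi ish]; first exact: Sg.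
    by apply: Sh; rewrite ltn_subLR.
  split=> [i|].
    rewrite size_cat nth_cat; case: (ltnP i (size r)) => [ig _|gi ish]; first exact: Or.
    by apply: Os; rewrite ltn_subLR.
  rewrite size_cat big_split_ord /=; congr (_ + _); apply: eq_bigr => i _ /=.
    by rewrite !nth_cat -sgr ltn_ord.
  by rewrite !nth_cat -sgr ltnNge leq_addr /= addKn.
exists g, [seq a * x | x <- r]; split; first by rewrite size_map.
split=> //; split=> [i|].
  by rewrite size_map => ir; rewrite (nth_map 0) //; apply: ofM => //; apply: Or.
rewrite mulr_sumr; apply: eq_bigr => i _.
by rewrite (nth_map 0) ?mulrA // -sgr.
Qed.

Local Notation "A ** B" := (ideal_mul F A B) (at level 40, left associativity).

Lemma omod_mul A B : omod F (A ** B). Proof. exact: omod_gen. Qed.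
Hint Resolve omod_mul : core.

Lemma mul_mem (A B : cset) a b : A a -> B b -> (A ** B) (a * b).
Proof. by move=> Aa Bb; apply: gen_mem; exists a, b. Qed.

Lemma mul_min (A B M : cset) :
  omod F M -> (forall a b, A a -> B b -> M (a * b)) -> csub (A ** B) M.
Proof. by move=> oM ABM; apply: gen_min => // _ [a [b [Aa [Bb ->]]]]; apply: ABM. Qed.

Lemma mul_mono A A' B B' : csub A A' -> csub B B' -> csub (A ** B) (A' ** B').
Proof. by move=> sA sB; apply: mul_min => // a b /sA Aa /sB Bb; apply: mul_mem. Qed.

Lemma mulC A B : A ** B = B ** A.
Proof.
by apply: csub_antisym; apply: mul_min => // a b Aa Bb; rewrite mulrC; apply: mul_mem.
Qed.

Lemma mulA A B C : A ** (B ** C) = A ** B ** C.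
Proof.
apply: csub_antisym; apply: mul_min => // a b.
  rewrite mulrC => Aa; move: b; apply: (mul_min (omod_colon a _)) => // b c Bb Cc.
  by rewrite mulrAC [b * a]mulrC; apply: mul_mem => //; apply: mul_mem.
move=> + Cb; move: a; apply: (mul_min (omod_colon b _)) => // a c Aa Bc.
by rewrite -mulrA; apply: mul_mem => //; apply: mul_mem.
Qed.

Lemma mulAC A B C : A ** B ** C = A ** C ** B.
Proof. by rewrite -mulA (mulC B) mulA. Qed.

Lemma mulACA A B C D : A ** B ** (C ** D) = A ** C ** (B ** D).
Proof. by rewrite !mulA (mulAC A B C). Qed.

Lemma mul1 A : omod F A -> OF F ** A = A.
Proof.
move=> oA; apply: csub_antisym.
  by apply: mul_min => // a b Oa Ab; case: oA => _ [_]; apply.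
by move=> a Aa; rewrite -[a]mul1r; apply: mul_mem => //; apply: of1.
Qed.

Lemma mulI1 A : omod F A -> A ** OF F = A. Proof. by rewrite mulC; apply: mul1. Qed.

Lemma mul_scale x A B : scale x A ** B = scale x (A ** B).
Proof.
apply: csub_antisym.
  apply: mul_min; first exact: omod_scale.
  by move=> _ b [a [Aa ->]] Bb; rewrite -mulrA; apply/scale_mem/mul_mem.
move=> _ [y [ABy ->]]; rewrite mulrC; move: y ABy.
apply: (mul_min (omod_colon x _)) => // a b Aa Bb.
by rewrite mulrC mulrA; apply: mul_mem => //; apply: scale_mem.
Qed.

Lemma mul_scaler x A B : A ** scale x B = scale x (A ** B).
Proof. by rewrite mulC mul_scale mulC. Qed.

Lemma principalE a : principal_gen F a = scale a (OF F).
Proof.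
apply: csub_antisym.
  apply: gen_min => [|_ ->]; first exact/omod_scale/omod_OF.
  by rewrite -[a]mulr1 -{2}[a]mulr1 mulr1; apply/scale_mem/of1.
move=> _ [r [Or ->]]; have [_ [_ MM]] := omod_gen (fun x => x = a).
by rewrite mulrC; apply: MM => //; apply: gen_mem.
Qed.

Lemma scale_mul a A : omod F A -> scale a (OF F) ** A = scale a A.
Proof. by move=> oA; rewrite mul_scale mul1. Qed.

Lemma int_idealP A : int_ideal F A <-> omod F A /\ csub A (OF F).
Proof.
split=> [[AO [A0 [AD AM]]]|[[A0 [AD AM]] AO]]; first by split.
by do 3!split=> //.
Qed.

Lemma sub_mulr A B : omod F B -> csub A (OF F) -> csub (A ** B) B.
Proof. by move=> oB AO; rewrite -{2}(mul1 oB); apply: mul_mono. Qed.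

Lemma sub_mull A B : omod F A -> csub B (OF F) -> csub (A ** B) A.
Proof. by move=> oA BO; rewrite mulC; apply: sub_mulr. Qed.

Lemma pow_int P n : csub P (OF F) -> omod F (ideal_pow F P n) /\ csub (ideal_pow F P n) (OF F).
Proof.
move=> PO; elim: n => [|n [oP IH]] /=; first by split=> //; apply: omod_OF.
by split=> //; apply: csub_trans IH; apply: sub_mull.
Qed.

Lemma powD P m n : csub P (OF F) -> ideal_pow F P (m + n) = ideal_pow F P m ** ideal_pow F P n.
Proof.
move=> PO; elim: n => [|n IH]; first by rewrite addn0 /= mulI1 //; case: (pow_int m PO).
by rewrite addnS /= IH mulA.
Qed.

(* If [x] is in [A] and [y] in [B], then [(x y / a) ^ 2] is integral, hence so is [x y / a]; thus [A B] is contained in [(a)] and [a A = A B B] in [a B]. *)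
Lemma sqrt_ideal_sub A B a : omod F A -> omod F B -> csub A F -> csub B F -> F a -> a != 0 ->
  A ** A = scale a (OF F) -> B ** B = scale a (OF F) -> csub A B.
Proof.
move=> oA oB AF BF Fa a0 AA BB.
have AB : csub (A ** B) (scale a (OF F)).
  apply: mul_min => [|x y Ax By]; first exact/omod_scale/omod_OF.
  have: (A ** A) (x * x) by apply: mul_mem.
  have: (B ** B) (y * y) by apply: mul_mem.
  rewrite AA BB => -[s [[_ As] Es]] [r [[_ Ar] Er]].
  exists (x * y / a); split; last by rewrite mulrCA mulfV ?mulr1.
  split; first by apply: sfM; [apply: sfM; [apply: AF | apply: BF] | apply: sfV].
  apply: Aint_sqr; have -> : (x * y / a) ^+ 2 = r * s.
    by rewrite expr2 mulrACA [x * y * _]mulrACA Er Es; field.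
  exact: rpredM.
move=> x Ax.
have: (A ** (B ** B)) (x * a).
  by apply: mul_mem => //; rewrite BB -[X in _ _ _ X]mulr1; apply/scale_mem/of1.
rewrite mulA => /(mul_mono AB (fun _ => id)); rewrite scale_mul // => -[b [Bb]].
by rewrite mulrC => /(mulfI a0) ->.
Qed.

Lemma sqrt_ideal_uniq A B a : omod F A -> omod F B -> csub A F -> csub B F -> F a -> a != 0 ->
  A ** A = scale a (OF F) -> B ** B = scale a (OF F) -> A = B.
Proof. by move=> *; apply: csub_antisym; apply: (@sqrt_ideal_sub _ _ a). Qed.

Lemma sqrt_ideal_int A a : csub A F -> OF F a -> A ** A = scale a (OF F) -> csub A (OF F).
Proof.
move=> AF Oa AA x Ax; split; first exact: AF.
have : (A ** A) (x * x) by apply: mul_mem.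
by rewrite AA -expr2 => -[r [[_ Ar] Er]]; apply: Aint_sqr; rewrite Er rpredM //; case: Oa.
Qed.

End Subfield.

Lemma mem_scale F a : is_subfield F -> scale a (OF F) a.
Proof. by move=> hF; rewrite -[X in scale _ _ X]mulr1; apply/scale_mem/of1. Qed.

Lemma scale_unit F u : is_subfield F -> EF F u -> scale u (OF F) = OF F.
Proof.
move=> hF [Ou [v [Ov uv]]]; apply: csub_antisym => [_ [r [Or ->]]|x Ox]; first exact: ofM.
have -> : x = u * (v * x) by rewrite mulrA uv mul1r.
exact/scale_mem/ofM.
Qed.

Lemma principalP F A : is_subfield F ->
  principal F A <-> exists a, OF F a /\ A = scale a (OF F).
Proof.
move=> hF; split=> [[a [Oa /cset_ext->]]|[a [Oa ->]]]; exists a; split=> //.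
  exact: principalE.
by rewrite principalE.
Qed.

Lemma principal_squareP K a A : is_subfield K ->
  set_eq (principal_gen K a) (ideal_mul K A A) <-> ideal_mul K A A = scale a (OF K).
Proof.
move=> hK; rewrite principalE //; split=> [/cset_ext->//|->]; first by [].
Qed.

Lemma EF_neq0 F x : EF F x -> x != 0.
Proof.
by case=> _ [y [_ xy]]; apply: contra_eq_neq xy => ->; rewrite mul0r eq_sym oner_eq0.
Qed.

Lemma EF_mul F x y : is_subfield F -> EF F x -> EF F y -> EF F (x * y).
Proof.
move=> hF [Ox [x' [Ox' xx']]] [Oy [y' [Oy' yy']]]; split; first exact: ofM.
by exists (x' * y'); split; [apply: ofM | rewrite mulrACA xx' yy' mulr1].
Qed.

Lemma EF_inv F x : is_subfield F -> EF F x -> EF F x^-1.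
Proof.
move=> hF Ex; have x0 := EF_neq0 Ex; case: Ex => Ox [y [Oy xy]].
have -> : x^-1 = y by apply: (mulfI x0); rewrite xy mulfV.
by split=> //; exists x; rewrite mulrC.
Qed.

(** * Finiteness of residue rings *)

(** With [d] the degree of F, the coordinate matrix of [d.+1] elements has a nonzero kernel vector
    [v]; multiplying it by the product [N] of its denominators gives integers. *)
Lemma number_field_dep F : number_field F -> exists d : nat, forall x : nat -> algC,
  (forall i, (i < d.+1)%N -> F (x i)) ->
  exists c : nat -> int, (exists2 i, (i < d.+1)%N & c i != 0) /\
    \sum_(i < d.+1) (c i)%:~R * x i = 0.
Proof.
case=> hF [s [_ [sP _]]]; exists (size s) => x Fx.
have /fin_all_exists[a Ha] (i : 'I_(size s).+1) : exists a : 'rV[rat]_(size s),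
    x i = \sum_(j < size s) ratr (a 0 j) * s`_j.
  have /sP[c [sc [Qc ->]]] := Fx i (ltn_ord i).
  have /fin_all_exists[a Ha] (j : 'I_(size s)) : exists a : rat, c`_j = ratr a.
    by apply/CratP/Qc; rewrite sc.
  by exists (\row_j a j); apply: eq_bigr => j _; rewrite mxE Ha.
pose M := \matrix_i a i.
have /rowV0Pn[v /sub_kermxP vM v0] : kermx M != 0.
  by rewrite -mxrank_eq0 mxrank_ker subn_eq0 -ltnNge ltnS rank_leq_col.
pose c (i : 'I_(size s).+1) := numq (v 0 i) * \prod_(j | j != i) denq (v 0 j).
pose N := \prod_j denq (v 0 j).
have cE i : (c i)%:~R = v 0 i * N%:~R :> rat.
  rewrite /c /N (bigD1 i (P := xpredT)) //= !intrM mulrA; congr (_ * _).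
  by rewrite numqE.
have N0 : N != 0 by apply/prodf_neq0 => j _; apply: denq_neq0.
exists (fun i => c (inord i)); split.
  have [i vi] : exists i, v 0 i != 0.
    apply/existsP; apply: contraNT v0 => /existsPn vi; apply/eqP/rowP=> i.
    by rewrite mxE; apply/eqP; have := vi i; rewrite negbK.
  exists i => //; rewrite inord_val -(intr_eq0 rat) cE mulf_neq0 // intr_eq0 //.
transitivity (\sum_(j < size s) ratr (N%:~R * (v *m M) 0 j) * s`_j : algC); last first.
  by rewrite vM big1 // => j _; rewrite mxE mulr0 rmorph0 mul0r.
under eq_bigr => i _ do rewrite inord_val Ha mulr_sumr.
rewrite exchange_big; apply: eq_bigr => j _ /=.
rewrite mxE mulr_sumr rmorph_sum mulr_suml; apply: eq_bigr => i _ /=.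
by rewrite mxE mulrA -ratr_int cE -rmorphM /= mulrCA mulrA.
Qed.

Section Finiteness.

Variable F : cset.
Hypothesis nF : number_field F.
Let hF : is_subfield F := proj1 nF.

Definition int_comb (c : nat -> int) (s : seq algC) : algC :=
  \sum_(i < size s) (c i)%:~R * s`_i.

Lemma int_comb_cons c x s :
  int_comb c (x :: s) = (c 0)%:~R * x + int_comb (fun i => c i.+1) s.
Proof. by rewrite /int_comb big_ord_recl. Qed.

Lemma int_combZ k c s : int_comb (fun i => k * c i) s = k%:~R * int_comb c s.
Proof. by rewrite mulr_sumr; apply: eq_bigr => i _; rewrite intrM mulrA. Qed.

(** For prime [p], this is linear independence over the field with [p] elements of the images of [s]
    in O_F / p O_F. *)
Definition mod_indep (p : nat) (s : seq algC) : Prop :=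
  (forall t, t \in s -> OF F t) /\
  forall c y, OF F y -> int_comb c s = p%:R * y -> forall i, (i < size s)%N -> (p %| c i)%Z.

(** A longer family has a nontrivial integer relation. Independence makes all its coefficients
    divisible by [p], and the divided relation still holds: an infinite descent on a nonzero
    coefficient. *)
Lemma mod_indep_bound p : prime p -> exists d, forall s, mod_indep p s -> (size s <= d)%N.
Proof.
move=> pr_p; have [d Hd] := number_field_dep nF; exists d => s [Os Is].
rewrite leqNgt; apply/negP => ds.
have [i si|c [[i0 i0d ci0] cs]] := Hd (fun i => s`_i).
  by have [] := Os s`_i (mem_nth 0 (leq_trans si ds)).
(* The relation concerns the first [d.+1] elements of [s]; the remaining coefficients are set to
   0. *)
have [c' [c'0 c's]] : exists c : nat -> int, c i0 != 0 /\ int_comb c s = 0.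
  exists (fun i => if (i < d.+1)%N then c i else 0); rewrite i0d; split=> //.
  rewrite -[RHS]cs (big_ord_widen _ (fun i => (c i)%:~R * s`_i) ds) big_mkcond /=.
  by apply: eq_bigr => i _; case: ifP; rewrite ?mul0r.
have i0s := leq_trans i0d ds.
have [n] := ubnP (absz (c' i0)); elim: n c' c'0 c's => // n IH c' c'0 c's c'n.
have pc' := Is c' 0 (of0 hF) (etrans c's (esym (mulr0 _))).
pose q i := (c' i %/ p)%Z.
have c'E i : (i < size s)%N -> c' i = p%:Z * q i by move=> /pc'/divzK; rewrite mulrC.
have p0 : p%:Z != 0 by rewrite -lt0n prime_gt0.
apply: (IH q).
- by apply: contraNneq c'0 => q0; rewrite c'E // q0 mulr0.
- apply: (@mulfI _ p%:Z%:~R); first by rewrite intr_eq0.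
  by rewrite mulr0 -int_combZ -c's; apply: eq_bigr => i _; rewrite c'E.
- have := prime_gt1 pr_p; move: c'n c'0; rewrite (c'E _ i0s) abszM /=.
  move: (q i0) => qi; nia.
Qed.

(** An independent family of maximal size spans O_F modulo [p]: an element outside the span could be
    adjoined, against the bound on the size. *)
Lemma mod_indep_max p : prime p -> exists s, (forall t, t \in s -> OF F t) /\
  forall x, OF F x -> exists c y, OF F y /\ x = int_comb c s + p%:R * y.
Proof.
move=> pr_p; apply: NNPP => no_s.
have [d Hd] := mod_indep_bound pr_p.
suff [s [Is ss]] : exists s, mod_indep p s /\ size s = d.+1.
  by have := Hd s Is; rewrite ss ltnn.
elim: d.+1 => [|n [s [[Os Is] ss]]]; first by exists [::].
have [x [Ox Hx]] : exists x, OF F x /\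
    ~ exists c y, OF F y /\ x = int_comb c s + p%:R * y.
  apply: NNPP => H; apply: no_s; exists s; split=> // x Ox.
  by apply: NNPP => H'; apply: H; exists x.
exists (x :: s); split; last by rewrite /= ss.
split=> [t|c y Oy]; first by rewrite inE => /orP[/eqP->|/Os].
rewrite int_comb_cons => Ec.
(* Otherwise Bezout inverts the coefficient of [x] modulo [p], which puts [x] in the span of [s]. *)
have pc0 : (p %| c 0%N)%Z.
  apply: NNPP => /negP npc; apply: Hx.
  have /coprimezP[[a b] /= ab] : coprimez (c 0%N) p by rewrite coprimez_sym coprimezE prime_coprime.
  exists (fun i => - a * c i.+1), (a%:~R * y + b%:~R * x); split.
    by apply: ofD => //; apply: ofM => //; apply: of_int.
  have ab' : a%:~R * (c 0%N)%:~R + b%:~R * p%:R = 1 :> algC.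
    by rewrite -[1 in RHS]/(1%:~R) -ab intrD !intrM.
  rewrite int_combZ; transitivity ((a%:~R * (c 0%N)%:~R + b%:~R * p%:R) * x).
    by rewrite ab' mul1r.
  have -> : int_comb (fun i => c i.+1) s = p%:R * y - (c 0%N)%:~R * x by rewrite -Ec; ring.
  rewrite mulrNz; ring.
have /dvdzP[k Ek] := pc0.
have E' : int_comb (fun i => c i.+1) s = p%:R * (y - k%:~R * x).
  by rewrite mulrBr -Ec Ek intrM -[p%:~R]/(p%:R); ring.
have Oy' : OF F (y - k%:~R * x) by apply: ofB => //; apply: ofM => //; apply: of_int.
by have H := Is _ _ Oy' E'; case=> //= i; apply: H.
Qed.

Lemma int_comb_mod p s : (0 < p)%N -> (forall t, t \in s -> OF F t) ->
  exists ts : seq algC, (forall t, t \in ts -> OF F t) /\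
  forall c, exists t y, t \in ts /\ OF F y /\ int_comb c s = t + p%:R * y.
Proof.
move=> p0; elim: s => [|x s IH] Os.
  exists [:: 0]; split=> [t|c]; first by rewrite inE => /eqP->; apply: of0.
  exists 0, 0; rewrite mem_head /int_comb big_ord0; split=> //; split; first exact: of0.
  by rewrite mulr0 addr0.
have Ox : OF F x by apply: Os; apply: mem_head.
have [|ts [Ots Hts]] := IH; first by move=> t ts; apply: Os; rewrite inE ts orbT.
exists [seq r%:R * x + t | r <- iota 0 p, t <- ts]; split=> [_ /allpairsP[[r t] /= [_ /Ots Ot ->]]|c].
  by apply: ofD => //; apply: ofM => //; apply: of_nat.
have [t [y [tts [Oy Ey]]]] := Hts (fun i => c i.+1).
have cr : (0 <= c 0%N %% p)%Z by rewrite modz_ge0 // -lt0n.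
have cp : (c 0%N %% p < p)%Z by rewrite ltz_pmod.
exists ((absz (c 0%N %% p)%Z)%:R * x + t), ((c 0%N %/ p)%Z%:~R * x + y); split.
  apply/allpairsP; exists (absz (c 0%N %% p)%Z, t); split=> //=.
  by rewrite mem_iota add0n; lia.
split; first by apply: ofD => //; apply: ofM => //; apply: of_int.
have Er : (absz (c 0%N %% p)%Z)%:R = (c 0%N %% p)%Z%:~R :> algC.
  by rewrite -[in RHS](gez0_abs cr).
rewrite Er int_comb_cons Ey {1}(divz_eq (c 0%N) p) intrD intrM -[p%:~R]/(p%:R).
ring.
Qed.

(** Strong induction splitting off the least prime factor [p]: representatives modulo [N] are
    [u + p * t] with [u] from those modulo [p] and [t] from those modulo [N / p]. *)
Lemma finite_quotient_nat N : (0 < N)%N ->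
  exists ts : seq algC, (forall t, t \in ts -> OF F t) /\
  forall x, OF F x -> exists t y, t \in ts /\ OF F y /\ x = t + N%:R * y.
Proof.
have [n] := ubnP N; elim: n N => // n IH N; rewrite ltnS => Nn N0.
have [N1|N1] := leqP N 1.
  exists [:: 0]; split=> [t|x Ox]; first by rewrite inE => /eqP->; apply: of0.
  exists 0, x; rewrite mem_head; do 2!split=> //.
  by have -> : N = 1%N by [lia]; rewrite add0r mul1r.
have pr_p := pdiv_prime N1; set p := pdiv N in pr_p.
have DN : N = (p * (N %/ p))%N by rewrite mulnC divnK // pdiv_dvd.
have M0 : (0 < N %/ p)%N by rewrite divn_gt0 ?prime_gt0 // dvdn_leq // pdiv_dvd.
have [|ts [Ots Hts]] := IH (N %/ p)%N _ M0.
  by rewrite (leq_trans _ Nn) // ltn_Pdiv // prime_gt1.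
have [s [Os Hs]] := mod_indep_max pr_p.
have [us [Ous Hus]] := int_comb_mod (prime_gt0 pr_p) Os.
exists [seq u + p%:R * t | u <- us, t <- ts]; split=> [_ /allpairsP[[u t] /= [/Ous Ou /Ots Ot ->]]|x Ox].
  by apply: ofD => //; apply: ofM => //; apply: of_nat.
have [c [y [Oy ->]]] := Hs x Ox.
have [u [z [uus [Oz ->]]]] := Hus c.
have [t [v [tts [Ov Ev]]]] := Hts (z + y) (ofD hF Oz Oy).
exists (u + p%:R * t), v; split; first by apply/allpairsP; exists (u, t).
split=> //; rewrite DN natrM -addrA -mulrDr Ev; ring.
Qed.

(** Some positive integer [N] is a multiple of [d] in O_F, so representatives modulo [N] also serve
    modulo [d]. *)
Lemma finite_quotient d : OF F d -> d != 0 ->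
  exists ts : seq algC, (forall t, t \in ts -> OF F t) /\
  forall x, OF F x -> exists t y, t \in ts /\ OF F y /\ x = t + d * y.
Proof.
move=> Od d0; have [N N0 AN] := Aint_multiplier d^-1.
have [|ts [Ots Hts]] := @finite_quotient_nat N; first by rewrite lt0n.
exists ts; split=> // x /Hts[t [y [tts [Oy ->]]]].
exists t, (N%:R * d^-1 * y); split=> //; split.
  apply: ofM => //; split=> //; apply: sfM => //; first exact: sf_nat.
  by apply: sfV => //; case: Od.
by congr (_ + _); field.
Qed.

(** An ideal containing [d] is determined by which of the finitely many representatives modulo [d]
    it contains, and a strictly larger ideal contains more of them. *)
Lemma noetherian_ind d (Q : cset -> Prop) : OF F d -> d != 0 ->
  (forall I, omod F I -> csub I (OF F) -> I d ->
    (forall J, omod F J -> csub J (OF F) -> csub I J -> J <> I -> Q J) -> Q I) ->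
  forall I, omod F I -> csub I (OF F) -> I d -> Q I.
Proof.
move=> Od d0 HQ I oI IO Id; have [ts [Ots Hts]] := finite_quotient Od d0.
(* The list [us] covers the representatives that may still lie outside [I]; each enlargement of the
   ideal removes one. *)
suff H n : forall us I, (size us < n)%N -> omod F I -> csub I (OF F) -> I d ->
    (forall t, t \in ts -> I t \/ t \in us) -> Q I.
  by apply: (H (size ts).+1 ts) => // t; right.
elim: n => // n IH us {oI IO Id}I usn oI IO Id Hus; apply: HQ => // J oJ JO IJ JI.
have [x [Jx nIx]] : exists x, J x /\ ~ I x.
  apply: NNPP => H; apply: JI; apply: csub_antisym => // x Jx.
  by apply: NNPP => nIx; apply: H; exists x.
have [t [y [tts [Oy Ex]]]] := Hts x (JO x Jx).
have Jt : J t.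
  have -> : t = x - d * y by rewrite Ex addrK.
  apply: (omodB hF oJ) => //; case: oJ => _ [_ MJ]; rewrite mulrC; apply: MJ => //.
  exact: IJ.
have tus : t \in us.
  have [It|//] := Hus t tts; case: nIx; rewrite Ex; case: oI => _ [DI MI].
  by apply: DI => //; rewrite mulrC; apply: MI.
apply: (IH (rem t us)) => //; last 1 first.
- move=> u /Hus[/IJ|uus]; first by left.
  have [->|ut] := eqVneq u t; [by left | right].
  by move: uus; rewrite (perm_mem (perm_to_rem tus)) inE (negPf ut).
- by rewrite size_rem //; case: us usn tus {Hus} => //= a us; rewrite ltnS.
- exact: IJ.
Qed.

Lemma classical_filter (T : eqType) (P : T -> Prop) (s : seq T) :
  exists s' : seq T, forall t, t \in s' <-> t \in s /\ P t.
Proof.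
elim: s => [|x s [s' IH]]; first by exists [::] => t; split=> [|[]].
have [Px|nPx] := classic (P x).
  exists (x :: s') => t; rewrite !inE; split=> [/orP[/eqP->|/IH[-> Pt]]|[]].
  - by rewrite eqxx.
  - by rewrite orbT.
  - by case/orP => [/eqP->|ts Pt]; rewrite ?eqxx // (proj2 (IH t)) ?orbT.
exists s' => t; rewrite inE IH; split=> [[-> Pt]|[]]; first by rewrite orbT.
by case/orP => [/eqP->|].
Qed.

Lemma ideal_fg I d : omod F I -> csub I (OF F) -> I d -> d != 0 ->
  exists g : seq algC, (forall t, t \in g -> I t) /\
  forall x, I x -> exists t y, t \in g /\ OF F y /\ x = t + d * y.
Proof.
move=> oI IO Id d0; have [ts [Ots Hts]] := finite_quotient (IO d Id) d0.
have [g Hg] := classical_filter I ts; exists g; split=> [t /Hg[]//|x Ix].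
have [t [y [tts [Oy Ex]]]] := Hts x (IO x Ix); exists t, y; split=> //.
apply/Hg; split=> //; have -> : t = x - d * y by rewrite Ex addrK.
by apply: (omodB hF oI) => //; case: oI => _ [_ MI]; rewrite mulrC; apply: MI.
Qed.

(** Multiplication by [u] acts on a finite generating family of [I] through an integral matrix, of
    which [u] is an eigenvalue. *)
Lemma ideal_stabilizer_Aint I d u : omod F I -> csub I (OF F) -> I d -> d != 0 ->
  (forall x, I x -> I (u * x)) -> u \in Aint.
Proof.
move=> oI IO Id d0 uI; have [g [Ig Hg]] := ideal_fg oI IO Id d0.
pose g' := d :: g; pose n := (size g).+1.
have /fin_all_exists[r Hr] (i : 'I_n) : exists r : 'I_n -> algC,
    (forall j, r j \in Aint) /\ u * g'`_i = \sum_j r j * g'`_j.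
  have /uI/Hg[t [y [tg [[_ Ay] ->]]]] : I g'`_i.
    by have := mem_nth 0 (ltn_ord i : (i < size g')%N); rewrite inE => /orP[/eqP->|/Ig].
  have ti : (index t g < size g)%N by rewrite index_mem.
  (* The product [u * g'_i] is [t + d * y] with [t] in [g]: entry 1 at the position of [t], shifted
     by one because [d] heads [g'], and entry [y] at position 0. *)
  exists (fun j => (j == lift ord0 (Ordinal ti))%:R + (j == ord0)%:R * y).
  split=> [j|]; first by rewrite rpredD ?rpredM // rpred_nat.
  have D (k : 'I_n) (f : 'I_n -> algC) : \sum_j (j == k)%:R * f j = f k.
    by rewrite (bigD1 k) //= eqxx mul1r big1 ?addr0 // => j /negPf->; rewrite mul0r.
  under eq_bigr do rewrite mulrDl -mulrA.
  rewrite big_split (D _ (fun j => g'`_j)) (D _ (fun j => y * g'`_j)) /= nth_index //.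
  by rewrite mulrC.
apply: (@Aint_eigen n (\matrix_(i, j) r i j) (\col_i g'`_i)).
- by move=> i j; rewrite mxE; case: (Hr i).
- by apply: contraNneq d0 => H; have := congr1 (fun v : 'cV_n => v ord0 0) H; rewrite !mxE => H0; apply/eqP.
- apply/colP=> i; rewrite !mxE; have [_ ->] := Hr i.
  by apply: eq_bigr => j _; rewrite !mxE.
Qed.

End Finiteness.

(** * Prime ideals *)

Section Primes.

Variable F : cset.
Hypothesis nF : number_field F.
Let hF : is_subfield F := proj1 nF.
Local Notation "A ** B" := (ideal_mul F A B) (at level 40, left associativity).

(** Pigeonhole on the powers of [a] modulo [d]: two of them, with exponents [i] and [i + k.+1], are
    congruent. *)
Lemma power_cycle a d : OF F a -> OF F d -> d != 0 ->
  exists i k y, OF F y /\ a ^+ i * (1 - a ^+ k.+1) = d * y.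
Proof.
move=> Oa Od d0; have [ts [_ Hts]] := finite_quotient nF Od d0.
have /fin_all_exists[r Hr] (i : 'I_(size ts).+1) : exists r : 'I_(size ts), exists y,
    OF F y /\ a ^+ i = ts`_r + d * y.
  have [t [y [tts [Oy Ey]]]] := Hts _ (ofX hF i Oa).
  have it : (index t ts < size ts)%N by rewrite index_mem.
  by exists (Ordinal it), y; rewrite nth_index.
have /injectivePn[i0 [j0 ij0 rij0]] : ~~ injectiveb r.
  by apply/injectiveP => /leq_card; rewrite !card_ord ltnn.
have [i [j [ij rij]]] : exists i j : 'I_(size ts).+1, (i < j)%N /\ r i = r j.
  have [?|?|ij] := ltngtP i0 j0; [by exists i0, j0 | by exists j0, i0 |].
  by case/negP: ij0; apply/eqP/val_inj.
have [y [Oy Ey]] := Hr i; have [z [Oz Ez]] := Hr j.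
exists i, (j - i).-1, (y - z); split; first exact: ofB.
rewrite prednK ?subn_gt0 // mulrBr mulr1 -exprD subnKC ?(ltnW ij) //.
by rewrite Ey Ez rij; ring.
Qed.

Lemma prime_idealE P : prime_ideal F P -> omod F P /\ csub P (OF F).
Proof. by case=> [[/int_idealP]]. Qed.

(** Nonzero primes are maximal: modulo [P] some positive power [a ^+ k.+1] is 1, because [P]
    contains [a ^+ i * (1 - a ^+ k.+1)] but no power of [a]. So [a ^+ k] is an inverse of [a]. *)
Lemma prime_coprime P a : prime_ideal F P -> OF F a -> ~ P a ->
  exists p b, P p /\ OF F b /\ 1 = p + a * b.
Proof.
move=> pP Oa nPa; have [oP PO] := prime_idealE pP.
case: pP => [[_ [d [Pd d0]]] [P1 Pprime]].
have [i [k [y [Oy E]]]] := power_cycle Oa (PO d Pd) d0.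
have nPai n : ~ P (a ^+ n).
  elim: n => [|n IH]; first by rewrite expr0.
  by rewrite exprS => Pan; case: (Pprime _ _ Oa (ofX hF n Oa) Pan).
exists (1 - a ^+ k.+1), (a ^+ k); split; last by rewrite -exprS subrK; split=> //; apply: ofX.
have : P (a ^+ i * (1 - a ^+ k.+1)).
  by rewrite E mulrC; case: oP => _ [_]; apply.
have Ok : OF F (1 - a ^+ k.+1) by apply: ofB => //; [apply: of1 | apply: ofX].
by case/(Pprime _ _ (ofX hF i Oa) Ok) => // /nPai.
Qed.

Lemma first_failure (Q : nat -> Prop) n : ~ Q 0%N -> Q n -> exists e, ~ Q e /\ Q e.+1.
Proof.
move=> Q0; elim: n => // n IH Qn1; have [/IH//|nQn] := classic (Q n).
by exists n.
Qed.

(* [P] is generated by [d] and finitely many [t], each with a power killed modulo [(d)] by an element outside [P]; start from the product of these elements and multiply by the [t] as long as the result stays outside [(d)]. *)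
Lemma prime_annihilator P d : prime_ideal F P -> P d -> d != 0 ->
  exists b, OF F b /\ ~ scale d (OF F) b /\ forall p, P p -> scale d (OF F) (p * b).
Proof.
move=> pP Pd d0; have [oP PO] := prime_idealE pP; have Od := PO d Pd.
have [g [Pg Hg]] := ideal_fg nF oP PO Pd d0.
case: pP => [_ [P1 Pprime]].
have odO : omod F (scale d (OF F)) := omod_scale d (omod_OF hF).
have dOM r x : OF F r -> scale d (OF F) x -> scale d (OF F) (r * x).
  by case: odO => _ [_ +]; apply.
have dOP x : scale d (OF F) x -> P x.
  by case=> y [Oy ->]; rewrite mulrC; case: oP => _ [_]; apply.
suff H (h : seq algC) s : (forall t, t \in h -> P t) -> OF F s -> ~ P s -> exists c, OF F c /\
    ~ scale d (OF F) (s * c) /\ forall t, t \in h -> scale d (OF F) (t * (s * c)).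
  have [c [Oc [nc Hc]]] := H g 1 Pg (of1 hF) P1; rewrite mul1r in nc Hc.
  exists c; split=> //; split=> // p /Hg[t [y [tg [Oy ->]]]].
  rewrite mulrDl; case: odO => _ [+ _]; apply; first exact: Hc.
  by rewrite -mulrA; apply/scale_mem/ofM.
elim: h s => [|t h IH] s Ph Os nPs.
  by exists 1; split; [apply: of1 | rewrite mulr1; split=> // /dOP].
have Pt : P t by apply: Ph; apply: mem_head.
have Ot := PO t Pt.
have [i [k [y [Oy E]]]] := power_cycle Ot Od d0.
set st := 1 - t ^+ k.+1 in E.
have Ost : OF F st by apply: ofB => //; [apply: of1 | apply: ofX].
have nPst : ~ P st.
  move=> Pst; apply: P1; have -> : 1 = st + t ^+ k * t by rewrite -exprSr subrK.
  by case: oP => _ [DP MP]; apply: DP => //; apply: MP => //; apply: ofX.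
have Ph' u : u \in h -> P u by move=> uh; apply: Ph; rewrite inE uh orbT.
have nPsst : ~ P (s * st) by case/(Pprime _ _ Os Ost).
have [c [Oc [nc Hc]]] := IH (s * st) Ph' (ofM hF Os Ost) nPsst.
have [e [nQe Qe]] : exists e, ~ scale d (OF F) (s * st * c * t ^+ e) /\
    scale d (OF F) (s * st * c * t ^+ e.+1).
  apply: (@first_failure (fun e => scale d (OF F) (s * st * c * t ^+ e)) i).
    by rewrite expr0 mulr1.
  have -> : s * st * c * t ^+ i = d * (s * c * y) by rewrite -mulrCA -E; ring.
  by apply: scale_mem; do 2?apply: ofM.
exists (st * c * t ^+ e); split; first by do 2?apply: ofM => //; apply: ofX.
have -> : s * (st * c * t ^+ e) = s * st * c * t ^+ e by rewrite !mulrA.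
split=> // u; rewrite inE => /orP[/eqP->|/Hc Hu].
  by have -> : t * (s * st * c * t ^+ e) = s * st * c * t ^+ e.+1 by rewrite exprS; ring.
rewrite mulrA mulrC; apply: dOM => //; exact: ofX.
Qed.

(** With [P'] the ideal of those [x] for which [x P] lies in (d), it suffices that [P P' = (d)]; the
    inverse is then [P'] divided by [d]. *)
Lemma prime_inverse P : prime_ideal F P -> exists Pi,
  omod F Pi /\ csub Pi F /\ csub (OF F) Pi /\ P ** Pi = OF F.
Proof.
move=> pP; have [oP PO] := prime_idealE pP.
have [[_ [d [Pd d0]]] [P1 _]] := pP; have Od := PO d Pd.
have [b [Ob [nb Hb]]] := prime_annihilator pP Pd d0.
have odO : omod F (scale d (OF F)) := omod_scale d (omod_OF hF).
pose P' x := OF F x /\ forall p, P p -> scale d (OF F) (p * x).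
have oP' : omod F P'.
  split; first by split; [apply: of0 | move=> p _; rewrite mulr0; case: odO].
  case: odO => _ [dD dM].
  split=> [x y [Ox Hx] [Oy Hy]|r x Or [Ox Hx]]; split.
  - exact: ofD.
  - by move=> p Pp; rewrite mulrDr; apply: dD; [apply: Hx | apply: Hy].
  - exact: ofM.
  - by move=> p Pp; rewrite mulrCA; apply: dM => //; apply: Hx.
have P'd : P' d.
  by split=> // p /PO Op; rewrite mulrC; apply: scale_mem.
have P'b : P' b by [].
have PP' : P ** P' = scale d (OF F).
  apply: csub_antisym; first by apply: mul_min => // p x Pp [_]; apply.
  suff dPP : (P ** P') d.
    by move=> _ [y [Oy ->]]; rewrite mulrC; have [_ [_]] := omod_mul hF P P'; apply.
  (* If [b / d] mapped [P] into itself it would be integral, and [b] would lie in (d). Hence some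
     [y = b / d * p], which lies in O_F, is outside [P] and invertible modulo [P]; this expresses
     [d] through [P P']. *)
  have [p [Pp nPup]] : exists p, P p /\ ~ P (b / d * p).
    apply: NNPP => H; apply: nb.
    have Au : b / d \in Aint.
      apply: (ideal_stabilizer_Aint nF oP PO Pd d0) => p Pp.
      by apply: NNPP => nPup; apply: H; exists p.
    exists (b / d); split; last by field.
    by split=> //; apply: sfM => //; [case: Ob | apply: sfV => //; case: Od].
  have [y [Oy Ey]] := Hb p Pp.
  have Eup : b / d * p = y.
    by apply: (mulfI d0); rewrite -Ey; field.
  rewrite Eup in nPup.
  have [q [r [Pq [Or E1]]]] := prime_coprime pP Oy nPup.
  have -> : d = q * d + p * (r * b).
    by rewrite -[LHS]mulr1 E1 mulrDr mulrA -Ey; ring.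
  have [_ [DPP _]] := omod_mul hF P P'; apply: DPP; apply: mul_mem => //.
  by case: oP' => _ [_]; apply.
exists (scale d^-1 P'); split; first exact: omod_scale.
split; first by move=> _ [x [[[Fx _] _] ->]]; apply: sfM => //; apply: sfV => //; case: Od.
split.
  move=> x Ox; have -> : x = d^-1 * (x * d) by field.
  by apply: scale_mem; case: oP' => _ [_]; apply.
by rewrite mul_scaler // PP' scaleK.
Qed.

Lemma prime_contain_dvd P Pi A : omod F A -> P ** Pi = OF F -> csub A P ->
  A = P ** (Pi ** A) /\ csub (Pi ** A) (OF F).
Proof.
move=> oA PPi AP; split; first by rewrite mulA // PPi mul1.
by rewrite -PPi (mulC hF P); apply: mul_mono.
Qed.

(** If [P Z = Z], the inverse of [P] stabilizes [Z] and is therefore integral, so that O_F, its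
    product with [P], would lie in [P]. *)
Lemma prime_mul_neq P Z d : prime_ideal F P -> omod F Z -> csub Z (OF F) -> Z d -> d != 0 ->
  P ** Z <> Z.
Proof.
move=> pP oZ ZO Zd d0 PZ; have [Pi [oPi [PiF [_ PPi]]]] := prime_inverse pP.
have [oP _] := prime_idealE pP; case: pP => _ [P1 _]; apply: P1.
have PiZ : Pi ** Z = Z by rewrite -{1}PZ mulA // (mulC hF Pi) PPi mul1.
suff PiO : csub Pi (OF F).
  by apply: (sub_mull hF oP PiO); rewrite PPi; apply: of1.
move=> u Piu; split; first exact: PiF.
apply: (ideal_stabilizer_Aint nF oZ ZO Zd d0) => x Zx.
by rewrite -PiZ; apply: mul_mem.
Qed.

(** As long as [Z] lies in [P], multiplying by the inverse of [P] gives a strictly larger integral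
    ideal, so the process stops. *)
Lemma prime_valuation P Z d : prime_ideal F P -> omod F Z -> csub Z (OF F) -> Z d -> d != 0 ->
  exists n Y, omod F Y /\ csub Y (OF F) /\ ~ csub Y P /\ Z = ideal_pow F P n ** Y.
Proof.
move=> pP oZ ZO Zd d0; have [Pi [oPi [PiF [OPi PPi]]]] := prime_inverse pP.
have [oP PO] := prime_idealE pP.
have Od := ZO d Zd; move: Z oZ ZO Zd; apply: (noetherian_ind nF Od d0) => Z oZ ZO Zd IH.
have [ZP|nZP] := classic (csub Z P); last first.
  by exists 0%N, Z; rewrite /= mul1.
have [EZ PZO] := prime_contain_dvd oZ PPi ZP.
have sZ : csub Z (Pi ** Z).
  by rewrite -{1}(mul1 hF oZ); apply: mul_mono.
have [|n [Y [oY [YO [nYP E]]]]] := IH (Pi ** Z) (omod_mul hF _ _) PZO sZ.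
  move=> E; apply: (prime_mul_neq pP oZ ZO Zd d0).
  by rewrite -{1}E -EZ.
exists n.+1, Y; do 3!split=> //.
by rewrite EZ E mulA // (mulC hF P).
Qed.

Lemma prime_not_sub_mul P X Y : prime_ideal F P -> csub X (OF F) -> csub Y (OF F) ->
  ~ csub X P -> ~ csub Y P -> ~ csub (X ** Y) P.
Proof.
move=> [_ [_ Pprime]] XO YO nX nY XY; apply: nX => x Xx; apply: NNPP => nPx.
apply: nY => y Yy; have /XY Pxy : (X ** Y) (x * y) by apply: mul_mem.
by case: (Pprime _ _ (XO x Xx) (YO y Yy) Pxy).
Qed.

Lemma prime_pow_inj P X Y a b : prime_ideal F P -> omod F X -> omod F Y ->
  csub X (OF F) -> csub Y (OF F) -> ~ csub X P -> ~ csub Y P ->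
  ideal_pow F P a ** X = ideal_pow F P b ** Y -> a = b.
Proof.
move=> pP oX oY XO YO nX nY; have [Pi [oPi [_ [_ PPi]]]] := prime_inverse pP.
have [oP PO] := prime_idealE pP.
have powP n Z : csub Z (OF F) -> csub (ideal_pow F P n.+1 ** Z) P.
  move=> ZO; apply: csub_trans (sub_mull hF (omod_mul hF _ _) ZO) _.
  by apply: sub_mulr => //; case: (pow_int hF n PO).
elim: a b => [|a IH] [|b] //=.
- by rewrite mul1 // => E; case: nX; rewrite E; apply: powP.
- by rewrite [RHS]mul1 // => E; case: nY; rewrite -E; apply: powP.
move=> /(congr1 (fun Z => Pi ** Z)) E; congr _.+1; apply: IH.
have K Q Z : omod F Q -> Pi ** (Q ** P ** Z) = Q ** Z.
  by move=> oQ; rewrite mulA // (mulC hF Q) mulA // (mulC hF Pi) PPi mul1.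
by rewrite !K in E => //; case: (pow_int hF a PO); case: (pow_int hF b PO).
Qed.

(** Restates exactness by a cofactor outside [P], a form that is multiplicative since [P] is
    prime. *)
Lemma exact_powerP P x e : prime_ideal F P ->
  exact_power F P x e <->
  exists X, omod F X /\ csub X (OF F) /\ ~ csub X P /\ scale x (OF F) = ideal_pow F P e ** X.
Proof.
move=> pP; have [oP PO] := prime_idealE pP; have [Pi [oPi [_ [_ PPi]]]] := prime_inverse pP.
rewrite /exact_power /ideal_divides -principalE //.
split=> [[[X [/int_idealP[oX XO] /cset_ext E]] ndiv]|[X [oX [XO [nX E]]]]].
  exists X; do 2!split=> //; split=> // XP; apply: ndiv.
  have [EX PXO] := prime_contain_dvd oX PPi XP.
  exists (Pi ** X); split; first by apply/int_idealP; split=> //; apply: omod_mul.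
  by rewrite E {1}EX mulA.
split; first by exists X; split; [apply/int_idealP | rewrite E].
case=> Y [/int_idealP[oY YO] /cset_ext]; rewrite E => E'.
apply: nX; suff -> : X = P ** Y by apply: sub_mull.
have [Q HQ] : exists Q, Q ** ideal_pow F P e = OF F.
  elim: e {E E'} => [|e [Q HQ]]; first by exists (OF F); rewrite /= mul1 //; apply: omod_OF.
  exists (Q ** Pi) => /=; rewrite mulACA // HQ (mulC hF Pi) PPi mul1 //; exact: omod_OF.
by rewrite -[LHS](mul1 hF oX) -HQ -mulA // E' /= !mulA // HQ mul1.
Qed.

(** If [B] is not prime, take [a * b] in [B] with neither factor in [B], and pass to [J = B + (a)].
    It is proper: 1 in [J] would give [b] in [B]. *)
Lemma exists_prime B d : omod F B -> csub B (OF F) -> B d -> d != 0 -> ~ B 1 ->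
  exists P, prime_ideal F P /\ csub B P.
Proof.
move=> oB BO Bd d0; have Od := BO d Bd.
move: B oB BO Bd; apply: (noetherian_ind nF Od d0) => B oB BO Bd IH nB1.
have [pB|npB] := classic (prime_ideal F B); first by exists B; split=> // x.
have [a [b [Oa [Ob [Bab [nBa nBb]]]]]] : exists a b,
    OF F a /\ OF F b /\ B (a * b) /\ ~ B a /\ ~ B b.
  apply: NNPP => H; apply: npB; split; first by split; [apply/int_idealP | exists d].
  split=> // a b Oa Ob Bab; apply: NNPP => nBab; apply: H; exists a, b.
  by do 3!split=> //; split=> ?; apply: nBab; [left | right].
have [B0 [DB MB]] := oB.
pose J x := exists i r, B i /\ OF F r /\ x = i + r * a.
have oJ : omod F J.
  split; first by exists 0, 0; rewrite mul0r addr0; do 2!split=> //; apply: of0.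
  split=> [_ _ [i [r [Bi [Or ->]]]] [j [s [Bj [Os ->]]]]|s _ Os [i [r [Bi [Or ->]]]]].
    exists (i + j), (r + s); split; first exact: DB.
    by split; [apply: ofD | ring].
  exists (s * i), (s * r); split; first exact: MB.
  by split; [apply: ofM | ring].
have JO : csub J (OF F).
  by move=> _ [i [r [/BO Oi [Or ->]]]]; apply: ofD => //; apply: ofM.
have BJ : csub B J.
  by move=> x Bx; exists x, 0; rewrite mul0r addr0; do 2!split=> //; apply: of0.
have JB : J <> B.
  move=> E; apply: nBa; rewrite -E; exists 0, 1; rewrite add0r mul1r.
  by do 2!split=> //; apply: of1.
have [|P [pP JP]] := IH J oJ JO BJ JB; last by exists P; split=> //; apply: csub_trans JP.
case=> i [r [Bi [Or E1]]]; apply: nBb.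
have -> : b = b * i + r * (a * b) by rewrite -[LHS]mulr1 E1; ring.
by apply: DB; apply: MB.
Qed.

(** * Parity of valuations and square roots of ideals *)

(** The equation says that [x / y] is [delta] times the square of [u / v], with denominators cleared
    to stay in O_F. *)
Lemma square_even_valuation x y u v delta B P ex ey :
  prime_ideal F P -> OF F x -> OF F y -> OF F u -> OF F v ->
  x != 0 -> y != 0 -> u != 0 -> v != 0 -> delta != 0 ->
  x * v ^+ 2 = y * u ^+ 2 * delta ->
  omod F B -> csub B (OF F) -> B ** B = scale delta (OF F) ->
  exact_power F P x ex -> exact_power F P y ey -> ~~ odd (ex + ey).
Proof.
move=> pP Ox Oy Ou Ov x0 y0 u0 v0 delta0 E oB BO BB.
have [oP PO] := prime_idealE pP.
move=> /(exact_powerP _ _ pP)[X [oX [XO [nX EX]]]] /(exact_powerP _ _ pP)[Y [oY [YO [nY EY]]]].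
have Bd : B delta.
  apply: (sub_mulr hF oB BO); rewrite BB -[X in scale _ _ X]mulr1.
  exact/scale_mem/of1.
have sO z : OF F z -> csub (scale z (OF F)) (OF F).
  by move=> Oz _ [r [Or ->]]; apply: ofM.
have sz z : scale z (OF F) z by rewrite -[X in scale _ _ X]mulr1; exact/scale_mem/of1.
have osO z : omod F (scale z (OF F)) by apply/omod_scale/omod_OF.
have [n [B' [oB' [BO' [nB' EB]]]]] := prime_valuation pP oB BO Bd delta0.
have [a [U [oU [UO [nU EU]]]]] := prime_valuation pP (osO u) (sO _ Ou) (sz u) u0.
have [b [V [oV [VO [nV EV]]]]] := prime_valuation pP (osO v) (sO _ Ov) (sz v) v0.
have sM z t : scale (z * t) (OF F) = scale z (OF F) ** scale t (OF F).
  by rewrite mul_scale // mul1 // scale_scale.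
have := congr1 (fun z => scale z (OF F)) E.
rewrite !expr2 !sM -BB EX EY EU EV EB.
do 3!rewrite ?(mulACA hF (ideal_pow F P _) _ (ideal_pow F P _)) -?(powD hF _ _ PO).
have nn := prime_not_sub_mul pP.
have ssO Z W : omod F Z -> csub Z (OF F) -> csub W (OF F) -> csub (Z ** W) (OF F).
  by move=> oZ ZO WO; apply: csub_trans ZO; apply: sub_mull.
have om := omod_mul hF.
move/(prime_pow_inj pP) => H.
(* Equating the exponents of [P] gives [ex + 2 b = ey + 2 a + 2 n], so [ex + ey] is even. *)
have -> : (ex + ey = (ex + (b + b)) + (ey + (a + a) + (n + n)) - (b + a + n).*2)%N by lia.
rewrite H; try lia; auto 10.
Qed.

(** The square root is built up in [A], keeping [A A B = (alpha)]. For a prime [P] containing [B],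
    the exponent of [P] in [alpha] is twice that in [A] plus that in [B]; the latter is thus even,
    and half of it moves into [A]. *)
Lemma even_valuation_square alpha : OF F alpha -> alpha != 0 ->
  (forall P e, prime_ideal F P -> exact_power F P alpha e -> ~~ odd e) ->
  exists A, int_ideal F A /\ A ** A = scale alpha (OF F).
Proof.
move=> Oa a0 Hev.
suff H B : omod F B -> csub B (OF F) -> B alpha -> forall A, omod F A -> csub A (OF F) ->
    A ** A ** B = scale alpha (OF F) ->
    exists A, int_ideal F A /\ A ** A = scale alpha (OF F).
  apply: (H (scale alpha (OF F)) _ _ _ (OF F)) => //.
  - exact/omod_scale/omod_OF.
  - by move=> _ [r [Or ->]]; apply: ofM.
  - by rewrite -[X in scale _ _ X]mulr1; apply/scale_mem/of1.
  - exact: omod_OF.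
  - by rewrite !mul1 //; [apply/omod_scale/omod_OF | apply: omod_OF].
move: B; apply: (noetherian_ind nF Oa a0) => B oB BO Ba IH A oA AO E.
have [B1|nB1] := classic (B 1).
  exists A; split; first exact/int_idealP.
  rewrite -E; suff -> : B = OF F by rewrite mulI1 //; apply: omod_mul.
  apply: csub_antisym => // x Ox; rewrite -[x]mulr1.
  by case: oB => _ [_]; apply.
have [P [pP BP]] := exists_prime oB BO Ba a0 nB1; have [oP PO] := prime_idealE pP.
have Aa : A alpha.
  have AAO : csub (A ** B) (OF F) by apply: csub_trans BO; apply: sub_mulr.
  apply: (sub_mull hF oA AAO); rewrite mulA // E -[X in scale _ _ X]mulr1.
  exact/scale_mem/of1.
have [b [B' [oB' [BO' [nB' EB]]]]] := prime_valuation pP oB BO Ba a0.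
have [a [A' [oA' [AO' [nA' EA]]]]] := prime_valuation pP oA AO Aa a0.
have om := omod_mul hF.
have ssO Z W : omod F Z -> csub Z (OF F) -> csub W (OF F) -> csub (Z ** W) (OF F).
  by move=> oZ ZO WO; apply: csub_trans ZO; apply: sub_mull.
have nn := prime_not_sub_mul pP.
have /(Hev P _ pP) : exact_power F P alpha (a + a + b).
  apply/exact_powerP => //; exists (A' ** A' ** B'); split=> //.
  split; first by auto.
  split; first by auto.
  rewrite -E EA EB.
  by do 2!rewrite (mulACA hF (ideal_pow F P _) _ (ideal_pow F P _)) -(powD hF _ _ PO).
rewrite oddD oddD addbb /= => evb.
have Eb : b = (b./2 + b./2)%N by rewrite addnn -[LHS]odd_double_half (negPf evb).
have [oQ QO] := pow_int hF b./2 PO.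
apply: (IH B' oB' BO' _ _ (A ** ideal_pow F P b./2)) => //.
- by rewrite EB; apply: sub_mulr => //; case: (pow_int hF b PO).
- by move=> E'; apply: nB'; rewrite E'.
- by auto.
by rewrite mulACA // -powD // -Eb -mulA // -EB.
Qed.

End Primes.

(** * CM-fields *)

Lemma embedding_rmorph F (nu : {rmorphism algC -> algC}) : embedding F nu.
Proof. by split; [apply: rmorph1 | split=> x y _ _; [apply: rmorphD | apply: rmorphM]]. Qed.

Definition spans_quad (L K : cset) (beta : algC) : Prop :=
  forall x, L x <-> exists a b, K a /\ K b /\ x = a + b * beta.

Section CMField.

Variables L K : cset.
Hypothesis cmLK : CM_field L K.

Let nL : number_field L. Proof. by case: cmLK. Qed.
Let nK : number_field K. Proof. by case: cmLK => _ []. Qed.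
Let hL : is_subfield L := proj1 nL.
Let hK : is_subfield K := proj1 nK.
Let KL : csub K L. Proof. by case: cmLK => _ [_ []]. Qed.

Lemma aut_conj_K (nu : {rmorphism algC -> algC}) x : K x -> (nu x)^* = nu x.
Proof.
case: cmLK => _ [_ [_ [+ _]]] => /(_ _ (embedding_rmorph K nu) x) H Kx.
exact/CrealP/H.
Qed.

Lemma conj_K x : K x -> x^* = x. Proof. exact: (@aut_conj_K idfun). Qed.

(** The square of [nu beta] is real, so conjugation fixes or negates [nu beta]; if it fixed it, [nu]
    would embed all of L in the reals. *)
Lemma aut_conj_sqrt beta (nu : {rmorphism algC -> algC}) :
  spans_quad L K beta -> K (beta ^+ 2) -> (nu beta)^* = - nu beta.
Proof.
move=> Lbeta Kb2.
have : ((nu beta)^*) ^+ 2 == (nu beta) ^+ 2 by rewrite -3!rmorphXn /= (aut_conj_K nu Kb2).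
rewrite eqf_sqr => /orP[/eqP nub|/eqP//].
case: cmLK => _ [_ [_ [_ [+ _]]]] => /(_ _ (embedding_rmorph L nu))[x [/Lbeta[a [b [Ka [Kb ->]]]]]].
case/negP; apply/CrealP.
by rewrite !rmorphD !rmorphM /= nub !aut_conj_K.
Qed.

Lemma CM_sqrt_exists : exists beta, L beta /\ K (beta ^+ 2) /\ spans_quad L K beta.
Proof.
have [_ [_ [_ [Kreal [Lcomplex [s [s2 [sL [sP sfree]]]]]]]]] := cmLK.
have [g [Lg nKg]] : exists g, L g /\ ~ K g.
  have [x [Lx nrx]] := Lcomplex _ (embedding_rmorph L idfun).
  exists x; split=> // Kx; case/negP: nrx; apply: (Kreal _ (embedding_rmorph K idfun)) Kx.
have spanE x : L x <-> exists c d, K c /\ K d /\ x = c * s`_0 + d * s`_1.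
  rewrite sP; split=> [[c [sc [Kc ->]]]|[c [d [Kc [Kd ->]]]]].
    exists c`_0, c`_1; rewrite s2 big_ord_recl big_ord1 /=.
    by do 2?split=> //; apply: Kc; rewrite sc s2.
  exists [:: c; d]; split; first by rewrite s2.
  split=> [[|[|]]//|].
  by rewrite s2 big_ord_recl big_ord1.
have [c0 [c1 [Kc0 [Kc1 E1]]]] : exists c d, K c /\ K d /\ 1 = c * s`_0 + d * s`_1.
  exact: (proj1 (spanE _) (sf1 hL)).
have [d0 [d1 [Kd0 [Kd1 Eg]]]] : exists c d, K c /\ K d /\ g = c * s`_0 + d * s`_1.
  exact: (proj1 (spanE _) Lg).
(* The determinant of [1, g] in the basis [s]; its vanishing would make [g] a multiple of 1 over
   K. *)
pose D := c0 * d1 - c1 * d0.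
have KM := sfM hK; have KB := sfB hK; have KD := sfD hK; have KV := sfV hK.
have KX := sfX hK; have KN := sfN hK.
have D0 : D != 0.
  apply/eqP => D0; apply: nKg.
  have H0 : c0 * g = d0.
    have e : c0 * g - d0 * 1 = D * s`_1 by rewrite E1 Eg /D; ring.
    by apply/eqP; rewrite -subr_eq0; rewrite D0 mul0r mulr1 in e; rewrite e.
  have H1 : c1 * g = d1.
    have e : c1 * g - d1 * 1 = - D * s`_0 by rewrite E1 Eg /D; ring.
    by apply/eqP; rewrite -subr_eq0; rewrite D0 oppr0 mul0r mulr1 in e; rewrite e.
  have [c00|c00] := eqVneq c0 0.
    have c10 : c1 != 0.
      by apply: contra_neq (oner_neq0 algC) => c10; rewrite E1 c00 c10 !mul0r addr0.
    have -> : g = d1 / c1 by rewrite -H1; field.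
    by auto.
  have -> : g = d0 / c0 by rewrite -H0; field.
  by auto.
have KDD : K D by apply: KB; apply: KM.
have gP x : L x <-> exists a b, K a /\ K b /\ x = a + b * g.
  split=> [/spanE[c [d [Kc [Kd ->]]]]|[a [b [Ka [Kb ->]]]]].
    exists ((c * d1 - d * d0) / D), ((d * c0 - c * c1) / D); split; first by auto.
    split; first by auto.
    rewrite -[X in _ = X + _]mulr1 E1 Eg /D; field.
    exact: D0.
  by apply: sfD => //; [apply: KL | apply: sfM => //; apply: KL].
have [a [b [Ka [Kb Eg2]]]] : exists a b, K a /\ K b /\ g ^+ 2 = a + b * g.
  exact: (proj1 (gP _) (sfX hL 2 Lg)).
have K2 : K (b / 2%:R) by apply: KM => //; exact: (KV _ (sf_nat hK 2)).
(* Completing the square in [g ^+ 2 = a + b * g]. *)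
exists (g - b / 2%:R); split; first by apply: sfB => //; apply: KL.
split.
  have -> : (g - b / 2%:R) ^+ 2 = a + (b / 2%:R) ^+ 2.
    have -> : (g - b / 2%:R) ^+ 2 = g ^+ 2 - b * g + (b / 2%:R) ^+ 2 by field.
    by rewrite Eg2 addrK.
  by auto.
move=> x; rewrite gP; split=> -[u [v [Ku [Kv ->]]]].
  by exists (u + v * (b / 2%:R)), v; split; [|split] => //; [auto | ring].
by exists (u - v * (b / 2%:R)), v; split; [|split] => //; [auto | ring].
Qed.

(** This carries [x * x^* = 1] over to every conjugate of [x], as Kronecker's theorem requires. *)
Lemma aut_conj_L (nu : {rmorphism algC -> algC}) x : L x -> nu (x^*) = (nu x)^*.
Proof.
have [beta [_ [Kb2 bP]]] := CM_sqrt_exists => /bP[a [b [Ka [Kb ->]]]].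
have := aut_conj_sqrt idfun bP Kb2; rewrite /= => cb.
rewrite !rmorphD !rmorphM /= cb rmorphN (aut_conj_sqrt _ bP Kb2).
by rewrite !aut_conj_K ?conj_K.
Qed.

Lemma conj_L x : L x -> L x^*.
Proof.
have [beta [Lb [Kb2 bP]]] := CM_sqrt_exists => /bP[a [b [Ka [Kb ->]]]].
have := aut_conj_sqrt idfun bP Kb2; rewrite /= => cb.
rewrite !rmorphD !rmorphM /= cb !conj_K //.
apply: sfD => //; first exact: KL.
by apply: sfM; [ | apply: KL | apply: sfN].
Qed.

Lemma real_K x : L x -> x^* = x -> K x.
Proof.
have [beta [Lb [Kb2 bP]]] := CM_sqrt_exists => /bP[a [b [Ka [Kb ->]]]].
have := aut_conj_sqrt idfun bP Kb2; rewrite /= => cb.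
rewrite !rmorphD !rmorphM /= cb !conj_K // => /addrI/eqP.
rewrite mulrN eq_sym -addr_eq0 -mulr2n -mulr_natr mulf_eq0 pnatr_eq0 orbF => /eqP->.
by rewrite addr0.
Qed.

Lemma of_conj x : OF L x -> OF L x^*.
Proof. by case=> Lx Ax; split; [apply: conj_L | have := Aint_aut Num.conj x; rewrite /= => ->]. Qed.

Lemma of_KL x : OF K x -> OF L x. Proof. by case=> /KL Lx Ax; split. Qed.

Lemma unit_circle_root x : OF L x -> x * x^* = 1 -> WF L x.
Proof.
move=> [Lx Ax] xx; split=> //.
have [|n n0 xn] := kronecker Ax; last by exists n.
move=> nu; have : `|nu x| ^+ 2 == 1 by rewrite normCK -aut_conj_L // -rmorphM xx rmorph1.
by rewrite sqrp_eq1 // => /eqP.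
Qed.

Lemma WF_conj x : WF L x -> x * x^* = 1.
Proof.
case=> _ [n [n0 xn]]; rewrite -normCK.
have : `|x| ^+ n == 1 by rewrite -normrX xn normr1.
by rewrite pexpr_eq1 // => /eqP->; rewrite expr1n.
Qed.

Lemma WF_OF x : WF L x -> OF L x.
Proof.
case=> Lx [n [n0 xn]]; split=> //; apply: (Aint_unity_root n0).
exact/unity_rootP.
Qed.

(* Writing [gamma] as an O_L-combination of elements [c_i] of [C], the norm [gamma * gamma^*] is a combination of the [c_i ^ 2], with norms as coefficients, and of the [c_i * c_j], with traces as coefficients. *)
Lemma capitulation_norm C gamma : omod K C -> csub C (OF K) -> (exists2 c, C c & c != 0) ->
  ideal_ext L C = scale gamma (OF L) ->
  [/\ gamma != 0, OF L gamma, WF L (gamma^* / gamma)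
    & ideal_mul K C C = scale (gamma * gamma^*) (OF K)].
Proof.
move=> oC CO [c0 Cc0 c00] E; pose I := ideal_ext L C.
have oI : omod L I := omod_gen hL C.
have IO : csub I (OF L) by apply: gen_min => [|c /CO/of_KL//]; apply: omod_OF.
have CI : csub C I := gen_mem hL (S := C).
have Ig : I gamma by rewrite /I E -[X in scale _ _ X]mulr1; apply/scale_mem/of1.
have g0 : gamma != 0.
  by apply: contraNneq c00 => g0; have := CI _ Cc0; rewrite /I E g0 => -[r [_ ->]]; rewrite mul0r.
have conjC c : C c -> c^* = c by move=> /CO[Kc _]; apply: conj_K.
have Iconj x : I x -> I x^*.
  move: x; apply: gen_min => [|c Cc]; last by rewrite conjC //; apply: CI.
  case: oI => [I0 [DI MI]]; split; first by rewrite rmorph0.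
  split=> [x y Ix Iy|r x Or Ix]; first by rewrite rmorphD; apply: DI.
  by rewrite rmorphM; apply: MI => //; apply: of_conj.
have Og := IO _ Ig; have gc0 : gamma^* != 0 by rewrite conjC_eq0.
split=> //.
  have := Iconj _ Ig; rewrite {1}/I E => -[r [Or Er]].
  have -> : gamma^* / gamma = r by rewrite Er; field.
  apply: unit_circle_root => //; have -> : r = gamma^* / gamma by rewrite Er; field.
  rewrite rmorphM fmorphV /= conjCK; field.
  by rewrite g0 gc0.
set M := ideal_mul K C C.
have oM : omod K M := omod_mul hK C C; have [M0 [DM MM]] := oM.
have trK r : OF L r -> OF K (r + r^*).
  move=> Or; have [Ls As] := ofD hL Or (of_conj Or); split=> //.
  by apply: real_K => //; rewrite rmorphD /= conjCK addrC.
have normK r : OF L r -> OF K (r * r^*).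
  move=> Or; have [Ls As] := ofM hL Or (of_conj Or); split=> //.
  by apply: real_K => //; rewrite rmorphM /= conjCK mulrC.
(* The polarization of the norm [x * x^*]. The multiplier [s] in [T1] and [T2] makes the claims
   stable under multiplication by O_L, so that [gen_min] applies. *)
pose T (x y : algC) := x * y^* + x^* * y.
have T1 x : I x -> forall s c, OF L s -> C c -> M (T (s * x) c).
  move: x; apply: gen_min => [|d Cd s c Os Cc]; last first.
    have -> : T (s * d) c = (s + s^*) * (d * c) by rewrite /T rmorphM /= (conjC c Cc) (conjC d Cd); ring.
    by apply: MM; [apply: trK | apply: mul_mem].
  split; first by move=> s c _ _; rewrite /T mulr0 rmorph0 !mul0r addr0.
  split=> [x y Hx Hy s c Os Cc|r x Or Hx s c Os Cc]; last first.
    by rewrite mulrA; apply: Hx => //; apply: ofM.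
  have -> : T (s * (x + y)) c = T (s * x) c + T (s * y) c by rewrite /T mulrDr rmorphD /=; ring.
  by apply: DM; [apply: Hx | apply: Hy].
have T2 x y : I x -> I y -> forall s, OF L s -> M (T x (s * y)).
  move=> Ix; move: y; apply: gen_min => [|c Cc s Os]; last first.
    have -> : T x (s * c) = T (s^* * x) c by rewrite /T !rmorphM /= conjCK; ring.
    by apply: T1 => //; apply: of_conj.
  split; first by move=> s _; rewrite /T mulr0 rmorph0 !mulr0 addr0.
  split=> [y z Hy Hz s Os|r y Or Hy s Os]; last first.
    by rewrite mulrA; apply: Hy => //; apply: ofM.
  have -> : T x (s * (y + z)) = T x (s * y) + T x (s * z) by rewrite /T mulrDr rmorphD /=; ring.
  by apply: DM; [apply: Hy | apply: Hz].
(* Membership in [I] is carried along because the additive step calls [T2]. *)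
have N x : I x -> I x /\ M (x * x^*).
  move: x; apply: gen_min => [|c Cc]; last first.
    by split; [apply: CI | rewrite conjC //; apply: mul_mem].
  case: (oI) => [I0 [DI MI]]; split; first by rewrite mul0r.
  split=> [x y [Ix Mx] [Iy My]|r x Or [Ix Mx]]; split.
  - exact: DI.
  - have -> : (x + y) * (x + y)^* = x * x^* + y * y^* + T x (1 * y) by rewrite /T mul1r rmorphD /=; ring.
    by apply: (DM); [apply: (DM) => // | apply: T2 => //; apply: of1].
  - exact: MI.
  - have -> : r * x * (r * x)^* = (r * r^*) * (x * x^*) by rewrite rmorphM /=; ring.
    by apply: MM => //; apply: normK.
apply: csub_antisym.
  apply: mul_min => [|c d Cc Cd]; first exact/omod_scale/omod_OF.
  have := CI _ Cc; have := CI _ Cd; rewrite /I E => -[s [Os Es]] [r [Or Er]].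
  have Ecd : c * d = gamma * gamma^* * (r * s^*) by rewrite -[d]conjC // Er Es rmorphM /=; ring.
  exists (r * s^*); split=> //.
  have [Lrs Ars] := ofM hL Or (of_conj Os); split=> //.
  have -> : r * s^* = c * d / (gamma * gamma^*) by rewrite Ecd; field; rewrite g0 gc0.
  apply: sfM => //; first by apply: sfM => //; [case: (CO _ Cc) | case: (CO _ Cd)].
  by apply: sfV => //; case: (normK _ Og).
have [_ Ng] := N _ Ig.
by move=> _ [r [Or ->]]; rewrite mulrC; apply: MM.
Qed.

Lemma WF_mul x y : WF L x -> WF L y -> WF L (x * y).
Proof.
move=> [Lx [m [m0 xm]]] [Ly [n [n0 yn]]]; split; first exact: sfM.
exists (m * n)%N; split; first by rewrite muln_gt0 m0.
by rewrite exprMn exprM xm expr1n mulnC exprM yn expr1n mulr1.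
Qed.

Lemma WF_inv x : WF L x -> WF L x^-1.
Proof.
move=> [Lx [m [m0 xm]]]; split; first exact: sfV.
by exists m; split=> //; rewrite exprVn xm invr1.
Qed.

Lemma WF_neq0 x : WF L x -> x != 0.
Proof. by move=> /WF_conj; apply: contra_eq_neq => ->; rewrite mul0r eq_sym oner_eq0. Qed.

Lemma WF_conjV x : WF L x -> x^* = x^-1.
Proof. by move=> Wx; apply: (mulfI (WF_neq0 Wx)); rewrite WF_conj // mulfV // WF_neq0. Qed.

Lemma WF_EF x : WF L x -> EF L x.
Proof.
by move=> Wx; split; [apply: WF_OF | exists x^-1; split; [apply/WF_OF/WF_inv | rewrite mulfV // WF_neq0]].
Qed.

Lemma WF1 : WF L 1. Proof. by split; [apply: sf1 | exists 1%N; rewrite expr1n]. Qed.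

Lemma EF_conj x : EF L x -> EF L x^*.
Proof.
case=> Ox [y [Oy xy]]; split; first exact: of_conj.
by exists y^*; split; [apply: of_conj | rewrite -rmorphM xy rmorph1].
Qed.

Lemma unit_conj_ratio e : EF L e -> WF L (e^* / e).
Proof.
move=> Ee; have e0 := EF_neq0 Ee; have Ec := EF_conj Ee; have ec0 := EF_neq0 Ec.
apply: unit_circle_root; first by have [] := EF_mul hL Ec (EF_inv hL Ee).
by rewrite rmorphM fmorphV /= conjCK; field; rewrite e0 ec0.
Qed.

(** A root of unity is inverted by conjugation, so [e^* = xi ^+ 2 * e] says exactly that [xi * e] is
    fixed, hence a unit of K. *)
Lemma WE_P e : EF L e -> WE L K e <-> exists2 xi, WF L xi & e^* = xi ^+ 2 * e.
Proof.
move=> Ee; split=> [[u [f [Wu [[[Kf _] _] ->]]]]|[xi Wx Ec]].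
  exists u^-1; first exact: WF_inv.
  by rewrite rmorphM /= (conj_K Kf) WF_conjV //; field; apply: WF_neq0.
have x0 := WF_neq0 Wx; have e0 := EF_neq0 Ee.
have Exe := EF_mul hL (WF_EF Wx) Ee.
have real y : OF L y -> y^* = y -> OF K y by move=> [Ly Ay] yr; split=> //; apply: real_K.
have xer : (xi * e)^* = xi * e by rewrite rmorphM /= Ec WF_conjV //; field.
exists xi^-1, (xi * e); split; first exact: WF_inv.
split; last by field.
split; first by apply: real => //; case: Exe.
exists (xi * e)^-1; split; last by rewrite mulfV // mulf_neq0.
by apply: real; [case: (EF_inv hL Exe) | rewrite fmorphV /= xer].
Qed.

Lemma unit_index1 : (forall e, EF L e -> WE L K e) -> unit_index L K 1.
Proof.
move=> H; exists [:: 1]; split=> //; split=> [[]// _|x Ex].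
  by apply/WF_EF/WF1.
split; first by exists 0%N; split=> //; rewrite divr1; apply: H.
by move=> [|i] [|j].
Qed.

Lemma spans_quad_neq0 beta : spans_quad L K beta -> beta != 0.
Proof.
move=> bP; apply/eqP => b0.
case: cmLK => _ [_ [_ [_ [+ _]]]] => /(_ _ (embedding_rmorph L idfun))[x [/bP[a [b [Ka [_ ->]]]]]].
by rewrite b0 mulr0 addr0 /= => /negP; apply; apply/CrealP; apply: (conj_K).
Qed.

Lemma spans_quad_conj beta : L beta -> beta != 0 -> beta^* = - beta -> spans_quad L K beta.
Proof.
move=> Lb b0 cb x; split=> [Lx|[a [b [Ka [Kb ->]]]]]; last first.
  by apply: sfD => //; [apply: KL | apply: sfM => //; apply: KL].
have Lc := conj_L Lx; have L2 := sf_nat hL 2.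
exists ((x + x^*) / 2%:R), ((x - x^*) / (2%:R * beta)); split; last split.
- apply: (real_K); first by apply: sfM => //; [apply: sfD | apply: sfV].
  by rewrite rmorphM fmorphV rmorphD rmorph_nat /= conjCK addrC.
- apply: (real_K).
    by apply: sfM => //; [apply: sfB | apply: sfV => //; apply: sfM].
  rewrite rmorphM fmorphV rmorphM rmorphB rmorph_nat /= conjCK cb; field.
  by rewrite b0.
- by field.
Qed.

Lemma integral_sqrt_exists : exists beta, OF L beta /\ OF K (beta ^+ 2) /\ spans_quad L K beta.
Proof.
have [beta [Lb [Kb2 bP]]] := CM_sqrt_exists; have b0 := spans_quad_neq0 bP.
have [N N0 AN] := Aint_multiplier beta; have KN := sf_nat hK N.
exists (N%:R * beta); split; first by split=> //; apply: sfM => //; apply: sf_nat.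
split; first by rewrite exprMn; split; [apply: sfM => //; apply: sfX | rewrite -exprMn rpredX].
apply: spans_quad_conj; first by apply: sfM => //; apply: sf_nat.
  by rewrite mulf_neq0 ?pnatr_eq0.
have cb : beta^* = - beta := aut_conj_sqrt idfun bP Kb2.
by rewrite rmorphM rmorph_nat /= cb mulrN.
Qed.

(** Ramification may be witnessed by another [alpha]. Both square roots change sign under
    conjugation, so their quotient [k] lies in K and [alpha = k ^+ 2 * delta]; [N] clears the
    denominator of [k]. *)
Lemma square_not_ramified delta B : gen_by_sqrt L K delta -> OF K delta -> int_ideal K B ->
  ideal_mul K B B = scale delta (OF K) -> ~ essentially_ramified L K.
Proof.
move=> [Kd [beta [Lb [b2 bP]]]] Od /int_idealP[oB BO] BB.
move=> [alpha [[Ka [beta' [Lb' [b2' bP']]]] [P [x [y [ex [ey [pP [Ox [Oy [x0 [y0 [E [Px [Py odde]]]]]]]]]]]]]]].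
have b0 := spans_quad_neq0 bP; have b0' := spans_quad_neq0 bP'.
pose k := beta' / beta.
have Kk : K k.
  apply: (real_K); first by apply: sfM => //; apply: sfV.
  have cb : beta^* = - beta by apply: (aut_conj_sqrt idfun bP); rewrite b2.
  have cb' : beta'^* = - beta' by apply: (aut_conj_sqrt idfun bP'); rewrite b2'.
  by rewrite /k rmorphM fmorphV /= cb cb' invrN mulrNN.
have k0 : k != 0 by rewrite mulf_neq0 ?invr_eq0.
have [N N0 AN] := Aint_multiplier k.
move: odde; apply/negP; apply: (square_even_valuation nK pP Ox Oy (u := N%:R * k) (v := N%:R)
  (delta := delta) (B := B)) => //.
- by split=> //; apply: sfM => //; apply: sf_nat.
- exact: of_nat.
- by rewrite mulf_neq0 ?pnatr_eq0.
- by rewrite pnatr_eq0.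
- by rewrite -b2 expf_neq0.
- by rewrite -E -b2' -b2 /k; field.
Qed.

Lemma unramified_square alpha : ~ essentially_ramified L K -> OF K alpha ->
  gen_by_sqrt L K alpha -> alpha != 0 ->
  exists A, int_ideal K A /\ ideal_mul K A A = scale alpha (OF K).
Proof.
move=> nram Oa ga a0; apply: (even_valuation_square nK Oa a0) => P e pP Pe.
apply/negP => oe; apply: nram; exists alpha; split=> //.
exists P, alpha, 1, e, 0%N; split=> //; split=> //; split; first exact: of1.
split=> //; split; first exact: oner_neq0.
split; first by rewrite mulr1.
split=> //; split; last by rewrite addn0.
apply/(exact_powerP nK _ _ pP); exists (OF K); split; first exact: omod_OF.
split=> //; split; first by move=> /(_ 1 (of1 hK)); case: pP => _ [].
by rewrite scale1 /= mul1 //; apply: omod_OF.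
Qed.

(** * Units and capitulation *)

(** Multiplication by a root of unity [x] permutes the list [s]; comparing the products gives
    [x ^+ w = 1]. Conversely there are at most [w] such roots. *)
Lemma roots_of_unity_group w : num_roots_of_unity L w ->
  (0 < w)%N /\ forall x, WF L x <-> x ^+ w = 1.
Proof.
case=> s [Us [sw Hs]].
have w0 : (0 < w)%N by rewrite -sw; case: s {Us sw} Hs => // /(_ 1)[/(_ (WF1))].
have WFw x : WF L x -> x ^+ w = 1.
  move=> Wx; have x0 := WF_neq0 Wx.
  have Ux : uniq [seq x * y | y <- s] by rewrite map_inj_uniq //; apply: mulfI.
  have sub : {subset [seq x * y | y <- s] <= s}.
    by move=> _ /mapP[y /Hs Wy ->]; apply/Hs; apply: (WF_mul).
  have [|_ eqs] := uniq_min_size Ux sub; first by rewrite size_map.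
  have : \prod_(z <- [seq x * y | y <- s]) z = \prod_(z <- s) z.
    by apply: perm_big; apply: uniq_perm.
  rewrite big_map big_split /= big_const_seq count_predT sw iter_mulr_1 => /eqP.
  have p0 : \prod_(i <- s) i != 0.
    by rewrite prodf_seq_neq0; apply/allP => y /Hs/WF_neq0.
  by rewrite -[in X in _ == X](mul1r (\prod_(z <- s) z)) (inj_eq (mulIf p0)) => /eqP.
split=> // x; split=> [/WFw//|xw].
apply/Hs; apply: contraT => xs.
have /(max_unity_roots w0) : all w.-unity_root (x :: s).
  by apply/allP => y; rewrite inE unity_rootE => /orP[/eqP->|/Hs/WFw->//]; rewrite xw.
by move=> /(_ _) /=; rewrite xs Us sw ltnn => /(_ isT).
Qed.

Section UnitIndex.

(* [omega] generates the roots of unity modulo squares, and [theta] realises [omega^-1] as a quotient [theta^* / theta]. *)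
Variables (w h : nat) (omega theta : algC).
Hypothesis WFw : forall x, WF L x <-> x ^+ w = 1.
Hypothesis wh : w = h.*2.
Hypothesis omegah : omega ^+ h = -1.
Hypothesis Otheta : OF L theta.
Hypothesis theta0 : theta != 0.
Hypothesis theta_conj : theta^* * omega = theta.

Let Pi := theta * theta^*.

Let Womega : WF L omega.
Proof. by apply/WFw; rewrite wh -muln2 exprM omegah sqrrN expr1n. Qed.

Let omega0 : omega != 0. Proof. exact: WF_neq0 Womega. Qed.

Let thetac0 : theta^* != 0. Proof. by rewrite conjC_eq0. Qed.

Let Pi0 : Pi != 0. Proof. exact: mulf_neq0. Qed.

Lemma theta_sqr : theta ^+ 2 = Pi * omega.
Proof. by rewrite expr2 -{2}theta_conj mulrA. Qed.

Let OPi : OF K Pi.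
Proof.
have [LP AP] := ofM hL Otheta (of_conj Otheta); split=> //.
by apply: (real_K) => //; rewrite rmorphM /= conjCK mulrC.
Qed.

(** The power [eta ^+ h] is 1 or -1. If it is 1, a square root of [eta] is again a wth root of
    unity; if it is -1, the factor [omega] corrects the sign. *)
Lemma root_of_unity_square eta : WF L eta ->
  exists2 xi, WF L xi & eta = xi ^+ 2 \/ eta * omega = xi ^+ 2.
Proof.
have sq x : x ^+ h = 1 -> exists2 xi, WF L xi & x = xi ^+ 2.
  move=> xh; exists (sqrtC x); last by rewrite sqrtCK.
  by apply/WFw; rewrite wh -mul2n exprM sqrtCK.
move=> /WFw; rewrite wh -muln2 exprM => /eqP; rewrite sqrf_eq1 => /orP[/eqP|/eqP eh].
  by case/sq => xi; exists xi => //; left.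
have /sq[xi Wxi E] : (eta * omega) ^+ h = 1 by rewrite exprMn eh omegah mulrNN mulr1.
by exists xi => //; right.
Qed.

Lemma omega_not_square xi : WF L xi -> xi ^+ 2 <> omega.
Proof.
move=> /WFw xw E; have : xi ^+ w == 1 by rewrite xw.
by rewrite wh -mul2n exprM E omegah eq_sym -addr_eq0 -[_ + _]/(2%:R) pnatr_eq0.
Qed.

(** Conjugation multiplies [gamma] by [xi ^+ 2 / omega], [xi] by [xi ^- 2] and [theta] by
    [omega^-1], so it fixes [k]; the norm of [xi] is 1. *)
Lemma twist_quotient gamma xi : L gamma -> gamma != 0 -> WF L xi ->
  gamma^* / gamma * omega = xi ^+ 2 ->
  let k := gamma * xi / theta in [/\ K k, k != 0 & gamma * gamma^* = k ^+ 2 * Pi].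
Proof.
move=> Lg g0 Wxi E k.
have xi0 := WF_neq0 Wxi; have Lt : L theta by case: Otheta.
have gc : gamma^* = xi ^+ 2 * gamma / omega by rewrite -E; field; rewrite omega0 g0.
have tc : theta^* = theta / omega by rewrite -{2}theta_conj; field.
split.
- apply: (real_K).
    by apply: sfM => //; [apply: sfM => //; case: Wxi | apply: sfV].
  rewrite /k !rmorphM fmorphV /= gc tc (WF_conjV Wxi); field.
  by rewrite xi0 theta0 omega0.
- by rewrite /k !mulf_neq0 ?invr_eq0.
- by rewrite /k /Pi gc tc; field; rewrite omega0 theta0.
Qed.

Lemma capitulation_dichotomy C : nonzero_ideal K C -> principal L (ideal_ext L C) ->
  principal K C \/ exists k B, K k /\ k != 0 /\ int_ideal K B /\
    ideal_mul K B B = scale Pi (OF K) /\ C = scale k B.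
Proof.
move=> [/int_idealP[oC CO] [c [Cc c0]]] /(principalP _ hL)[gamma [Og E]].
have [g0 _ Weta CC] := capitulation_norm oC CO (ex_intro2 _ _ c Cc c0) E.
have CK : csub C K by move=> x /CO[].
have Lg : L gamma by case: Og.
have [xi Wxi [Exi|Exi]] := root_of_unity_square Weta.
  (* Here [gamma * xi] is real, and its ideal in K has the same square as [C]; uniqueness of the
     root identifies the two. *)
  left; apply/principalP => //; exists (gamma * xi).
  have gc : gamma^* = xi ^+ 2 * gamma by rewrite -Exi; field.
  have Ok : OF K (gamma * xi).
    have [Lk Ak] := ofM hL Og (WF_OF Wxi); split=> //; apply: (real_K) => //.
    by rewrite rmorphM /= gc (WF_conjV Wxi); field; apply: WF_neq0 Wxi.
  split=> //; have Kk : K (gamma * xi) by case: Ok.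
  have osK : omod K (scale (gamma * xi) (OF K)) by apply/omod_scale/omod_OF.
  apply: (sqrt_ideal_uniq hK oC osK CK _ _ _ CC).
  - by move=> _ [r [[Kr _] ->]]; apply: sfM.
  - have -> : gamma * gamma^* = (gamma * xi) ^+ 2 by rewrite gc; ring.
    exact: sfX.
  - by rewrite mulf_neq0 ?conjC_eq0.
  - by rewrite mul_scale // mul_scaler // mul1 ?scale_scale ?gc //; [congr scale; ring | apply: omod_OF].
right; have [] := twist_quotient Lg g0 Wxi Exi; set k := gamma * xi / theta => Kk k0 Ngamma.
exists k, (scale k^-1 C); split=> //; split=> //.
have BB : ideal_mul K (scale k^-1 C) (scale k^-1 C) = scale Pi (OF K).
  by rewrite mul_scale // mul_scaler // CC !scale_scale Ngamma; congr scale; field.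
split; last by rewrite scaleVK.
apply/int_idealP; split; first exact: omod_scale.
apply: (sqrt_ideal_int hK _ OPi BB).
by move=> _ [r [/CK Kr ->]]; apply: sfM => //; apply: sfV.
Qed.

Lemma unit_not_WE e : EF L e -> ~ WE L K e ->
  exists2 xi, WF L xi & e^* / e * omega = xi ^+ 2.
Proof.
move=> Ee nWE; have e0 := EF_neq0 Ee.
have [xi Wxi [Exi|Exi]] := root_of_unity_square (unit_conj_ratio Ee); last by exists xi.
by case: nWE; apply/(WE_P Ee); exists xi => //; rewrite -Exi divfK.
Qed.

(** The norm of [e] is a unit of K and equals [k ^+ 2 * Pi], so the ideal generated by [k^-1] has
    square (Pi). *)
Lemma unit_not_WE_sqrt e : EF L e -> ~ WE L K e ->
  exists B, int_ideal K B /\ ideal_mul K B B = scale Pi (OF K) /\ principal K B.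
Proof.
move=> Ee nWE; have [xi Wxi Exi] := unit_not_WE Ee nWE.
have e0 := EF_neq0 Ee; have Le : L e by case: Ee => -[].
have [] := twist_quotient Le e0 Wxi Exi; set k := e * xi / theta => Kk k0 Ne.
have Eu : EF K (e * e^*).
  have real y : OF L y -> y^* = y -> OF K y by move=> [Ly Ay] yr; split=> //; apply: (real_K).
  have [Oee [y [Oy Ey]]] := EF_mul hL Ee (EF_conj Ee).
  split; first by apply: real => //; rewrite rmorphM /= conjCK mulrC.
  exists (e * e^*)^-1; split; last by rewrite mulfV // mulf_neq0 ?conjC_eq0.
  apply: real; first by case: (EF_inv hL (EF_mul hL Ee (EF_conj Ee))).
  by rewrite fmorphV rmorphM /= conjCK mulrC.
have BB : ideal_mul K (scale k^-1 (OF K)) (scale k^-1 (OF K)) = scale Pi (OF K).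
  have oK := omod_OF hK.
  rewrite mul_scale // mul_scaler // mul1 // -{1}(scale_unit hK Eu) !scale_scale Ne.
  by congr scale; field.
have BO : csub (scale k^-1 (OF K)) (OF K).
  apply: (sqrt_ideal_int hK _ OPi BB) => _ [r [[Kr _] ->]].
  by apply: sfM => //; apply: sfV.
exists (scale k^-1 (OF K)); split; first by apply/int_idealP; split=> //; apply/omod_scale/omod_OF.
split=> //; apply/principalP => //; exists k^-1; split=> //.
exact/BO/mem_scale.
Qed.

Lemma unit_index2 e0 : EF L e0 -> ~ WE L K e0 -> unit_index L K 2.
Proof.
move=> Ee0 nWE0; exists [:: 1; e0]; split=> //; split=> [[|[|]]//= _|x Ex].
  exact/(WF_EF)/(WF1).
have e00 := EF_neq0 Ee0; have x0 := EF_neq0 Ex.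
have Exe := EF_mul hL Ex (EF_inv hL Ee0).
(* Otherwise [e0], the quotient of [x] by [x / e0], would have conjugate ratio the square of
   [xi / ze]. *)
have not_both : WE L K x -> WE L K (x / e0) -> False.
  move=> /(WE_P Ex)[xi Wxi Exi] /(WE_P Exe)[ze Wze Eze]; apply: nWE0.
  have xi0 := WF_neq0 Wxi; have ze0 := WF_neq0 Wze.
  apply/(WE_P Ee0); exists (xi / ze); first by apply: (WF_mul) => //; apply: (WF_inv).
  have := Eze; rewrite rmorphM fmorphV /= Exi => /(congr1 (fun y => y * (e0 * e0^* / (x * ze ^+ 2)))).
  have ec0 : e0^* != 0 by rewrite conjC_eq0.
  have -> : xi ^+ 2 * x / e0^* * (e0 * e0^* / (x * ze ^+ 2)) = (xi / ze) ^+ 2 * e0.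
    by field; rewrite ec0 x0 ze0.
  have -> : ze ^+ 2 * (x / e0) * (e0 * e0^* / (x * ze ^+ 2)) = e0^*.
    by field; rewrite e00 x0 ze0.
  by move->.
split; last first.
  move=> [|[|i]] [|[|j]] //= _ _; rewrite !divr1 // => H1 H2.
    by case: (not_both H1 H2).
  by case: (not_both H2 H1).
have [WEx|nWEx] := classic (WE L K x); first by exists 0%N; split=> //=; rewrite divr1.
exists 1%N; split=> //=.
(* Both conjugate ratios are [omega^-1] times a square, so [omega] cancels in the ratio for
   [x / e0]. *)
have [xi Wxi Exi] := unit_not_WE Ex nWEx; have [ze Wze Eze] := unit_not_WE Ee0 nWE0.
have ze0 := WF_neq0 Wze.
apply/(WE_P Exe); exists (xi / ze); first by apply: (WF_mul) => //; apply: (WF_inv).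
have ec0 : e0^* != 0 by rewrite conjC_eq0.
rewrite rmorphM fmorphV expr_div_n /= -Exi -Eze; field.
by rewrite omega0 e00 x0 ec0.
Qed.

Lemma unit_index_not_square :
  ~ (exists B, int_ideal K B /\ ideal_mul K B B = scale Pi (OF K)) ->
  unit_index L K 1 /\ capitulation_trivial L K.
Proof.
move=> nB; split.
  apply: (unit_index1) => e Ee; apply: NNPP => /(unit_not_WE_sqrt Ee)[B [iB [BB _]]].
  by apply: nB; exists B.
move=> C nC /(capitulation_dichotomy nC)[//|[k [B [_ [_ [iB [BB _]]]]]]].
by case: nB; exists B.
Qed.

(** * Extension of ideals from K to L *)

Lemma ext_scale x A : ideal_ext L (scale x A) = scale x (ideal_ext L A).
Proof.
apply: csub_antisym.
  apply: gen_min => [|_ [a [Aa ->]]]; first exact/omod_scale/omod_gen.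
  exact/scale_mem/gen_mem.
move=> _ [y [Iy ->]]; rewrite mulrC; move: y Iy.
apply: (gen_min (omod_colon x (omod_gen hL _))) => a Aa.
by rewrite mulrC; apply: gen_mem => //; apply: scale_mem.
Qed.

Lemma ext_OF : ideal_ext L (OF K) = OF L.
Proof.
apply: csub_antisym; first by apply: gen_min => [|x /(of_KL)//]; apply: omod_OF.
move=> x Ox; rewrite -[x]mulr1; have [_ [_ MM]] := omod_gen hL (OF K).
by apply: MM => //; apply: gen_mem => //; apply: of1.
Qed.

Lemma ext_mul A B : ideal_ext L (ideal_mul K A B) = ideal_mul L (ideal_ext L A) (ideal_ext L B).
Proof.
apply: csub_antisym.
  apply: gen_min => [|x]; first exact: omod_mul.
  move: x; apply: gen_min => [|_ [a [b [Aa [Bb ->]]]]].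
    have [M0 [DM MM]] := omod_mul hL (ideal_ext L A) (ideal_ext L B).
    by split=> //; split=> // r x /(of_KL); apply: MM.
  by apply: mul_mem => //; apply: gen_mem.
apply: mul_min => [|a b Ia]; first exact: omod_gen.
rewrite mulrC; move: b; apply: (gen_min (omod_colon a (omod_gen hL _))) => b Bb.
rewrite mulrC; move: a Ia; apply: (gen_min (omod_colon b (omod_gen hL _))) => a Aa.
by apply: gen_mem => //; apply: mul_mem.
Qed.

(** If [B = (b)], then [Pi = b ^+ 2 * u] for a unit [u] and [theta / b] is a unit with square
    [u * omega]; its conjugate ratio [omega^-1] is not a square, so the index is 2. In all cases [B]
    extends to the ideal of L generated by [theta], so its powers capitulate. *)
Lemma unit_index_square B : int_ideal K B -> ideal_mul K B B = scale Pi (OF K) ->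
  (principal K B -> unit_index L K 2) /\
  (~ principal K B -> unit_index L K 1 /\ capitulation_gen L K B).
Proof.
move=> /int_idealP[oB BO] BB.
have BK : csub B K by move=> x /BO[].
have BK' B' : int_ideal K B' -> omod K B' /\ csub B' K.
  by move=> /int_idealP[oB' B'O]; split=> // x /B'O[].
have uniqB B' : int_ideal K B' -> ideal_mul K B' B' = scale Pi (OF K) -> B' = B.
  move=> /BK'[oB' B'K] BB'; apply: (sqrt_ideal_uniq hK oB' oB B'K BK _ Pi0 BB' BB).
  by case: OPi.
split=> [/(principalP _ hK)[b [Ob EB]]|nB].
  have b0 : b != 0.
    apply: contraNneq Pi0 => b0; have := mem_scale Pi hK; rewrite -BB EB b0 mul_scale //.
    by case=> y [_ ->]; rewrite mul0r.
  have [u [Eu EPi]] : exists u, EF K u /\ Pi = b ^+ 2 * u.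
    have oK := omod_OF hK.
    have BB' : scale (b ^+ 2) (OF K) = scale Pi (OF K).
      by rewrite -BB EB mul_scale // mul_scaler // mul1 // scale_scale expr2.
    have := mem_scale Pi hK; rewrite -BB' => -[u [Ou Eu]].
    have := mem_scale (b ^+ 2) hK; rewrite BB' => -[v [Ov Ev]].
    exists u; split=> //; split=> //; exists v; split=> //.
    apply: (mulfI (expf_neq0 2 b0)).
    by rewrite mulrA -Eu -Ev mulr1.
  have u0 := EF_neq0 Eu.
  have Ee : EF L (theta / b).
    have E2 : (theta / b) ^+ 2 = u * omega by rewrite expr_div_n theta_sqr EPi; field.
    have Euo : EF L (u * omega).
      apply: EF_mul => //; last exact: (WF_EF).
      by case: Eu => Ou [v [Ov uv]]; split; [exact: (of_KL Ou) | exists v; split=> //; exact: (of_KL Ov)].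
    have Lb : L (theta / b).
      by apply: sfM => //; [case: Otheta | apply: sfV => //; apply: KL; case: Ob].
    have [[_ Auo] [y [[Ly Ay] Ey]]] := Euo.
    split; first by split=> //; apply: Aint_sqr; rewrite E2.
    exists (theta / b)^-1; split; last by rewrite mulfV // mulf_neq0 ?invr_eq0.
    split; first exact: sfV.
    apply: Aint_sqr; rewrite exprVn E2.
    by have [[_]] := EF_inv hL Euo.
  apply: (unit_index2 Ee) => /(WE_P Ee)[xi Wxi].
  rewrite rmorphM fmorphV /= (conj_K (proj1 Ob)) -{2}theta_conj => E.
  have /(omega_not_square (WF_inv Wxi)) // : xi^-1 ^+ 2 = omega.
  have xi0 := WF_neq0 Wxi.
  apply: (mulfI (mulf_neq0 (expf_neq0 2 xi0) (mulf_neq0 thetac0 (invr_neq0 b0)))).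
  have -> : xi ^+ 2 * (theta^* / b) * xi^-1 ^+ 2 = theta^* / b by field; rewrite b0.
  by rewrite {1}E; field.
split.
  apply: (unit_index1) => e Ee; apply: NNPP => /(unit_not_WE_sqrt Ee)[B' [iB' [BB' pB']]].
  by apply: nB; rewrite -(uniqB B').
move=> C nC; split.
  case/(capitulation_dichotomy nC) => [/(principalP _ hK)[c [Oc EC]]|[k [B' [Kk [k0 [iB' [BB' EC]]]]]]].
    have c0 : c != 0.
      by case: nC => _ [x [+ x0]]; rewrite EC; apply: contraPneq => -> [r [_ Ex]]; rewrite Ex mul0r eqxx in x0.
    exists 0%N, 1, c; split; first exact: of1.
    split=> //; split; first exact: oner_neq0.
    by split=> //; rewrite scale1 EC.
  (* [C = k B] with [k] in K only; multiplying by [N] turns this into the integral relation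
     [N C = (N k) B] that [same_class] asks for. *)
  have [N N0 AN] := Aint_multiplier k.
  exists 1%N, N%:R, (N%:R * k); split; first exact: of_nat.
  split; first by split=> //; apply: sfM => //; apply: sf_nat.
  split; first by rewrite pnatr_eq0.
  split; first by rewrite mulf_neq0 ?pnatr_eq0.
  by rewrite /= mul1 // EC (uniqB B') // scale_scale.
case=> n [x [y [Ox [Oy [x0 [y0 /cset_ext Exy]]]]]].
have LI A : csub A (OF K) -> omod L (ideal_ext L A) /\ csub (ideal_ext L A) (OF L).
  move=> AO; split; first exact: omod_gen.
  by apply: gen_min => [|a /AO/(of_KL)//]; apply: omod_OF.
have oL := omod_OF hL.
(* Both sides have square (theta ^ 2), since [theta ^+ 2] and [Pi] differ by the unit [omega]. *)
have extB : ideal_ext L B = scale theta (OF L).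
  have [oI IO] := LI B BO.
  apply: (@sqrt_ideal_uniq L hL _ _ (theta ^+ 2)) => //.
  - exact: omod_scale.
  - by move=> z /IO[].
  - by move=> _ [r [Or ->]]; have [] := ofM hL Otheta Or.
  - by apply: sfX => //; case: Otheta.
  - exact: expf_neq0.
  - rewrite -ext_mul BB ext_scale ext_OF theta_sqr -scale_scale.
    by rewrite (scale_unit hL (WF_EF Womega)).
  - by rewrite mul_scale // mul_scaler // mul1 // scale_scale expr2.
have extBn : ideal_ext L (ideal_pow K B n) = scale (theta ^+ n) (OF L).
  elim: n {Exy} => [|n IH] /=; first by rewrite expr0 scale1 ext_OF.
  by rewrite ext_mul IH extB mul_scale // mul_scaler // mul1 // scale_scale exprSr.
have extC : ideal_ext L C = scale (x^-1 * (y * theta ^+ n)) (OF L).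
  apply: (scale_inj x0); rewrite -ext_scale Exy ext_scale extBn !scale_scale.
  by congr scale; field.
apply/principalP => //; exists (x^-1 * (y * theta ^+ n)); split=> //.
have CO : csub C (OF K) by case: nC => /int_idealP[].
by have [_ IO] := LI C CO; apply: IO; rewrite extC; apply: mem_scale.
Qed.

End UnitIndex.

End CMField.

Theorem theorem1 (L K : cset) (w : nat) :
  CM_field L K -> num_roots_of_unity L w ->
  ((w %% 4 = 2)%N ->
     (essentially_ramified L K -> unit_index L K 1 /\ capitulation_trivial L K) /\
     (~ essentially_ramified L K ->
        (exists alpha A, OF K alpha /\ gen_by_sqrt L K alpha /\ int_ideal K A /\
           set_eq (principal_gen K alpha) (ideal_mul K A A)) /\
        (forall alpha A, OF K alpha -> gen_by_sqrt L K alpha -> int_ideal K A ->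
           set_eq (principal_gen K alpha) (ideal_mul K A A) ->
           (principal K A -> unit_index L K 2) /\
           (~ principal K A -> unit_index L K 1 /\ capitulation_gen L K A)))) /\
  (forall m : nat, (2 <= m)%N -> (w %% 2 ^ m.+1 = 2 ^ m)%N ->
     ~ essentially_ramified L K /\
     ((~ exists B, int_ideal K B /\ set_eq (principal_gen K (pi_n m)) (ideal_mul K B B)) ->
        unit_index L K 1 /\ capitulation_trivial L K) /\
     (forall B, int_ideal K B -> set_eq (principal_gen K (pi_n m)) (ideal_mul K B B) ->
        (principal K B -> unit_index L K 2) /\
        (~ principal K B -> unit_index L K 1 /\ capitulation_gen L K B))).
Proof.
move=> cmLK numw; have [w0 WFw] := roots_of_unity_group cmLK numw.
have [[hL _] [[hK _] _]] := cmLK.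
(* The norm of a square root [beta] is [- beta ^+ 2], while the statement speaks of the ideal
   generated by [beta ^+ 2]. *)
have ENeg a : scale (- a) (OF K) = scale a (OF K).
  rewrite -mulN1r mulrC -scale_scale scale_unit //.
  by split; [apply/ofN/of1 | exists (-1); split; [apply/ofN/of1 | rewrite mulrNN mulr1]].
split=> [w4|m m2 wm].
  have wh : w = (w %/ 4).*2.+1.*2 by rewrite {1}(divn_eq w 4) w4; lia.
  have omegah : (-1 : algC) ^+ (w %/ 4).*2.+1 = -1 by rewrite -signr_odd /= odd_double.
  have conj_sqrt beta : spans_quad L K beta -> OF K (beta ^+ 2) -> beta^* = - beta.
    by move=> bP [Kb2 _]; apply: (aut_conj_sqrt cmLK idfun bP Kb2).
  have norm_sqrt beta : spans_quad L K beta -> OF K (beta ^+ 2) ->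
      scale (beta * beta^*) (OF K) = scale (beta ^+ 2) (OF K).
    by move=> bP Ob2; rewrite conj_sqrt // mulrN ENeg expr2.
  have [beta [Ob [Ob2 bP]]] := integral_sqrt_exists cmLK.
  have b0 := spans_quad_neq0 cmLK bP.
  have gb : gen_by_sqrt L K (beta ^+ 2).
    by case: Ob2 => Kb2 _; split=> //; exists beta; case: Ob.
  split=> [ram|nram].
    apply: (unit_index_not_square cmLK WFw wh omegah Ob b0) => [|[B [iB]]].
      by rewrite conj_sqrt // mulrNN mulr1.
    by rewrite norm_sqrt // => BB; exact: (square_not_ramified cmLK gb Ob2 iB BB ram).
  split=> [|alpha A Oa [Ka [beta' [Lb' [b2' bP']]]] iA /(principal_squareP _ _ hK) AA].
    have [A [iA AA]] := unramified_square cmLK nram Ob2 gb (expf_neq0 2 b0).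
    by exists (beta ^+ 2), A; do 3!split=> //; apply: (proj2 (principal_squareP _ _ hK)).
  have b0' := spans_quad_neq0 cmLK bP'; rewrite -b2' in Oa AA.
  apply: (unit_index_square cmLK WFw wh omegah _ b0') => //.
  - by split=> //; apply: Aint_sqr; case: Oa.
  - by rewrite conj_sqrt // mulrNN mulr1.
  - by rewrite norm_sqrt.
(* From here [m] is the original exponent minus 2, and [w = 2 ^ m.+2 * (2 q + 1)]. *)
case: m m2 wm => [|[|m]] // _ wm.
set z := zeta2 m.+2; set q := (w %/ 2 ^ m.+3)%N.
have zN : z ^+ (2 ^ m.+1) = -1 by rewrite rootCK // expn_gt0.
have wh : w = (2 ^ m.+1 * q.*2.+1)%N.*2.
  by rewrite {1}(divn_eq w (2 ^ m.+3)) wm -/q !expnS; lia.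
have omegah : z ^+ (2 ^ m.+1 * q.*2.+1) = -1.
  by rewrite exprM zN -signr_odd /= odd_double.
have Wz : WF L z by apply/WFw; rewrite wh -muln2 exprM omegah sqrrN expr1n.
have z0 := WF_neq0 Wz; have zc := WF_conjV Wz.
have Ot : OF L (1 + z) by apply: ofD => //; [apply: of1 | apply: WF_OF].
have t0 : 1 + z != 0.
  (* The exponent [2 ^ m.+1] is even, so [z = -1] would contradict [zN]. *)
  apply/eqP => /eqP; rewrite addrC addr_eq0 => /eqP zN1.
  have /eqP := zN; rewrite zN1 -signr_odd oddX /= expr0.
  by rewrite -addr_eq0 -[_ + _]/(2%:R) pnatr_eq0.
have tc : (1 + z)^* * z = 1 + z by rewrite rmorphD rmorph1 /= zc; field.
have Epi : pi_n m.+2 = (1 + z) * (1 + z)^*.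
  by rewrite rmorphD rmorph1 /= zc /pi_n -/z; field.
split.
  (* Since 4 divides [w], L is K(i), and -1 generates the unit ideal, the square of O_K. *)
  have iN : 'i ^+ 2 = -1 :> algC := sqrCi _.
  have Wi : WF L 'i.
    by apply/WFw; rewrite wh expnS -mul2n !exprM iN sqrrN !expr1n.
  have Li : L 'i by case: Wi.
  have i0 : 'i != 0 :> algC := neq0Ci _.
  have ON1 : OF K (-1) by apply/ofN/of1.
  have gi : gen_by_sqrt L K (-1).
    case: (ON1) => KN1 _; split=> //; exists 'i; do 2!split=> //.
    by apply: (spans_quad_conj cmLK) => //; apply: conjCi.
  apply: (square_not_ramified cmLK gi ON1 (B := OF K)).
    by apply/int_idealP; split=> //; apply: omod_OF.
  by rewrite ENeg scale1 mul1 //; apply: omod_OF.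
split=> [nB|B iB /(principal_squareP _ _ hK)].
  apply: (unit_index_not_square cmLK WFw wh omegah Ot t0 tc) => -[B [iB BB]].
  by apply: nB; exists B; split=> //; apply: (proj2 (principal_squareP _ _ hK)); rewrite Epi.
rewrite Epi => BB; exact: (unit_index_square cmLK WFw wh omegah Ot t0 tc iB BB).
Qed.
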